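(* Let $D\in\mathbb N$ be even, let $\underline{\pmb{\mathcal F}}(V_D)$ be the set of pairs $(E,k)$ with $E\in\mathcal F(V_D)$ and $k\in[0,D/2-\dim E]$, and for such $(E,k)$ let $f^k_E=\sum_{v\in E+v^k_E}v\in\mathbb C[V_D]$, where $\mathbb C[V_D]$ is the space of formal $\mathbb C$-linear combinations of elements of $V_D$ and $v^k_E\in V_D$ is as in the context. Then: (1) for any $k\in\mathbb N$, the elements $f^k_E$, with $E\in\mathcal F(V_D)$ such that $(E,k)\in\underline{\pmb{\mathcal F}}(V_D)$, form a $\mathbb C$-basis of the subspace $\mathbb C[V_D]_k$ of $\mathbb C[V_D]$ consisting of the linear combinations of elements $v\in V_D$ with $\tilde u(v)=k$; (2) $\{f^k_E:(E,k)\in\underline{\pmb{\mathcal F}}(V_D)\}$ is a $\mathbb C$-basis of $\mathbb C[V_D]$.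
   Context: $\mathbb F=\mathbb Z/2$; $[a,b]=\{z\in\mathbb Z:a\le z\le b\}$. For $D\in\mathbb N$ even, $V_D$ is the $\mathbb F$-vector space with basis $e_1,\dots,e_D$. $\mathcal I_D$ is the set of intervals $[a,b]$, $1\le a\le b\le D$; $e_I=\sum_{i\in I}e_i$; $R_D$ is the set of subsets of $\mathcal I_D$. For $D\ge2$, $i\in[1,D]$, $\xi_i:\mathcal I_{D-2}\to\mathcal I_D$ is: $\xi_i([a',b'])=[a'+2,b'+2]$ if $i\le a'$; $=[a',b']$ if $i\ge b'+2$; $=[a',b'+2]$ if $a'<i<b'+2$; $t_i(B')=\{\xi_i(I'):I'\in B'\}\sqcup\{[i,i]\}$ for $B'\in R_{D-2}$. Define $S_D\subset R_D$ inductively ($D$ even): $S_0=\{\emptyset\}$; for $D\ge2$, $B\in S_D$ iff $B=\emptyset$ or $B=t_i(B')$ for some $i\in[1,D]$, $B'\in S_{D-2}$. All $I\in B\in S_D$ have odd cardinality. $\mathbf E_B=\mathrm{span}\{e_I:I\in B\}$ (of dimension $|B|$); $\mathcal F(V_D)=\{\mathbf E_B:B\in S_D\}$ ($B$ is determined by $\mathbf E_B$). *Canonical intervals.* Let $E=\mathbf E_B\in\mathcal F(V_D)$, $\Delta=D-2|B|\ge0$. If $\Delta\ge1$ write $\bigcup_{I\in B}I=[a_1,b_1]\cup\dots\cup[a_s,b_s]$ with $a_i\le b_i$, $b_i+2\le a_{i+1}$; $b_0=-1$, $a_{s+1}=D+2$. Let $i_1<\dots<i_t$ be the $i\in[1,s+1]$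 with $a_i-b_{i-1}\ge3$. The intervals $[a_{i_u}-1,b_{i_{u+1}-1}+1]$ ($u\in[1,t-1]$) and $[j,j]$ for $j\in[b_{i-1}+2,a_i-2]$, $i\in[1,s+1]$ with $a_i-b_{i-1}\ge4$, are $\Delta$ consecutive disjoint intervals, listed from left to right as $I_1,\dots,I_\Delta$. *The vectors $v_E^k$.* Let $\Delta$ be even, $k\in[0,\Delta/2]$, and $P_k=\{[1,\Delta],[2,\Delta-1],\dots,[k,\Delta+1-k]\}$ ($P_0=\emptyset$). Let $\mathbf a$ be a symbol, and $\overline{[1,\Delta]}=[1,\Delta]\sqcup\{\mathbf a\}$. For $j\in\overline{[1,\Delta]}$ let $n_j$ be the number of $I\in P_k$ with $j\in\overline{[1,\Delta]}\setminus I$ (so $n_{\mathbf a}=k$), and let $w_k=\sum_{j\in\overline{[1,\Delta]}}\frac{n_j(n_j+1)}2e_j\in V_\Delta$, where $e_{\mathbf a}=e_1+\dots+e_\Delta$. Then $v^k_E$ is the image of $w_k$ under the linear map $V_\Delta\to V_D$, $e_c\mapsto e_{I_c}$ (and $v^0_E=0$). (For example $v_E^1=e_{I_1\cup\dots\cup I_\Delta}$.) *The function $\tilde u:V_D\to\mathbb N$.* Any $v\in V_D$ is uniquely $e_{[a_1,b_1]}+\dots+e_{[a_r,b_r]}$ with $1\le a_s\le b_s\le D$, $b_s+2\le a_{s+1}$; $u(v)=\sum_{s:\,a_s\not\equiv b_s\bmod2}(-1)^{a_s}$; $\tilde u(v)=2u(v)$ if $u(v)\ge0$, $\tilde u(v)=-2u(v)-1$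 if $u(v)<0$. *)

(* Defs.v *)
From mathcomp Require Import all_boot all_order all_algebra.
From mathcomp Require Import finmap complex reals.

Set Implicit Arguments.
Unset Strict Implicit.
Unset Printing Implicit Defensive.

Import GRing.Theory Num.Theory.
Local Open Scope ring_scope.

(* The pair (a, b) stands for the interval [a, b] = {a, a+1, ..., b}.  Indices
   are 1-based, as in the basis e_1, ..., e_D of V_D. *)
Definition intv : Type := (nat * nat)%type.

Definition in_intv (i : nat) (J : intv) : bool := (J.1 <= i <= J.2)%N.

Notation "''V_' D" := 'rV['F_2]_D (at level 8, D at level 2) : type_scope.

(* e_vec D i is e_i for i in [1, D] (and 0 for i outside [1, D]). *)
Definition e_vec (D i : nat) : 'V_D := \row_(j < D) (j.+1 == i)%:R.

Definition e_intv (D : nat) (J : intv) : 'V_D :=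
  \sum_(J.1 <= i < J.2.+1) e_vec D i.

Definition xi (i : nat) (J : intv) : intv :=
  if (i <= J.1)%N then (J.1 + 2, J.2 + 2)%N
  else if (J.2 + 2 <= i)%N then J
  else (J.1, J.2 + 2)%N.

(* The union is always disjoint: [i, i] is never of the form xi_i(I'). *)
Definition t_map (i : nat) (B : {fset intv}) : {fset intv} :=
  ([fset xi i J | J in B] `|` [fset (i, i)])%fset.

(* S_D for D even; the value at odd D is irrelevant. *)
Fixpoint S_set (D : nat) : {fset {fset intv}} :=
  match D with
  | D'.+2 =>
      (fset0 |` [fset t_map i B | i in iota 1 D'.+2, B in S_set D'])%fset
  | _ => [fset fset0]%fset
  end.

Definition E_of (D : nat) (B : {fset intv}) : {vspace 'V_D} :=
  <<[seq e_intv D J | J <- B]>>%VS.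

Definition F_set (D : nat) : {fset {vspace 'V_D}} :=
  [fset E_of D B | B in S_set D]%fset.

(* The B in S_D with E_B = E, for E in F(V_D); there is exactly one. *)
Definition B_of (D : nat) (E : {vspace 'V_D}) : {fset intv} :=
  head fset0 [seq B <- S_set D | E_of D B == E].

(* The maximal intervals [a_1, b_1], ..., [a_s, b_s] (so b_i + 2 <= a_{i+1}),
   from left to right, of the subset of [1, D] with characteristic function P;
   P must vanish outside [1, D]. *)
Definition runs (D : nat) (P : pred nat) : seq intv :=
  zip [seq x <- iota 1 D | P x && ~~ P x.-1]
      [seq x <- iota 1 D | P x && ~~ P x.+1].

Definition union_intv (B : {fset intv}) : pred nat :=
  fun x => has (in_intv x) B.

(* The pairs (b_{i-1} + 1, a_i) for i in [1, s+1], where b_0 = -1 and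
   a_{s+1} = D + 2; the shift of b_{i-1} by 1 keeps b_0 in nat. *)
Definition gaps (D : nat) (B : {fset intv}) : seq (nat * nat) :=
  let r := runs D (union_intv B) in
  zip (0%N :: [seq J.2.+1 | J <- r]) (rcons [seq J.1 | J <- r] D.+2).

(* The gaps with a_i - b_{i-1} >= 3, i.e. those with i = i_1, ..., i_t. *)
Definition wide_gaps (D : nat) (B : {fset intv}) : seq (nat * nat) :=
  [seq g <- gaps D B | (g.1 + 2 <= g.2)%N].

(* The intervals [a_{i_u} - 1, b_{i_{u+1} - 1} + 1] for u in [1, t-1]. *)
Definition joining_intervals (D : nat) (B : {fset intv}) : seq intv :=
  [seq (p.1.2.-1, p.2.1) | p <- zip (wide_gaps D B) (behead (wide_gaps D B))].

(* The intervals [j, j] with j in [b_{i-1} + 2, a_i - 2], a_i - b_{i-1} >= 4. *)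
Definition singleton_intervals (D : nat) (B : {fset intv}) : seq intv :=
  [seq (j, j) | g <- [seq g <- gaps D B | (g.1 + 3 <= g.2)%N],
                j <- index_iota g.1.+1 g.2.-1].

Definition canonical_intervals (D : nat) (B : {fset intv}) : seq intv :=
  sort (fun J K : intv => (J.1 <= K.1)%N)
    (joining_intervals D B ++ singleton_intervals D B).

Definition P_list (Delta k : nat) : seq intv :=
  [seq (h, Delta.+1 - h)%N | h <- iota 1 k].

(* [1, Delta] together with the symbol a is option 'I_Delta: Some c stands for
   c + 1 in [1, Delta], and None for a. *)
Definition in_intv_bar (Delta : nat) (j : option 'I_Delta) (J : intv) : bool :=
  if j is Some c then in_intv c.+1 J else false.

Definition e_bar (Delta : nat) (j : option 'I_Delta) : 'V_Delta :=
  if j is Some c then e_vec Delta c.+1 else \sum_(c < Delta) e_vec Delta c.+1.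

Definition n_bar (Delta k : nat) (j : option 'I_Delta) : nat :=
  count (fun J => ~~ in_intv_bar j J) (P_list Delta k).

Definition w_vec (Delta k : nat) : 'V_Delta :=
  \sum_(j : option 'I_Delta)
     (((n_bar k j * (n_bar k j).+1) %/ 2)%N%:R : 'F_2) *: e_bar j.

(* The image of w_k under the linear map V_Delta -> V_D, e_c |-> e_{I_c}, whose
   matrix (acting on row vectors) has the e_{I_c} as rows. *)
Definition v_vec (D : nat) (E : {vspace 'V_D}) (k : nat) : 'V_D :=
  let B := B_of E in
  let Delta := (D - 2 * #|` B|)%N in
  w_vec Delta k *m
    \matrix_(c < Delta) e_intv D (nth (0, 0)%N (canonical_intervals D B) c).

Definition supp (D : nat) (v : 'V_D) : pred nat :=
  fun x => [exists j : 'I_D, (j.+1 == x) && (v 0 j != 0)].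

(* The decomposition v = e_{[a_1, b_1]} + ... + e_{[a_r, b_r]} is given by the
   maximal intervals of the support of v. *)
Definition u_fun (D : nat) (v : 'V_D) : int :=
  \sum_(J <- runs D (supp v) | odd J.1 != odd J.2) (-1) ^+ J.1.

Definition u_tilde (D : nat) (v : 'V_D) : nat :=
  if 0 <= u_fun v then absz (2 * u_fun v)%R else absz (- (2 * u_fun v) - 1)%R.

(* C[V_D]: since V_D is finite, formal linear combinations are the functions
   V_D -> C, where C is R[i] for R the real numbers. *)
Notation "'CV' R D" := {ffun 'rV['F_2]_D -> (R[i])%C^o}
  (at level 10, R at level 8, D at level 8) : type_scope.

(* The element v of V_D, as an element of C[V_D]. *)
Definition formal (R : realType) (D : nat) (v : 'V_D) : CV R D :=
  [ffun x => (x == v)%:R].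

Definition f_elt (R : realType) (D : nat) (E : {vspace 'V_D}) (k : nat) :
    CV R D :=
  \sum_(v : 'V_D | v - v_vec E k \in E) formal R v.

Definition F_pairs (D : nat) : {fset {vspace 'V_D} * nat} :=
  [fset p in [seq (E, k) | E <- F_set D, k <- iota 0 (D %/ 2 - \dim E).+1]]%fset.

Definition CV_sub (R : realType) (D k : nat) : {vspace CV R D} :=
  <<[seq formal R v | v <- enum 'V_D & u_tilde v == k]>>%VS.

(* Main.v *)
Require Import Defs.
From HB Require Import structures.
From mathcomp Require Import all_boot all_order all_algebra.
From mathcomp Require Import finmap complex reals.
From mathcomp Require Import zify ring.

Set Implicit Arguments.
Unset Strict Implicit.
Unset Printing Implicit Defensive.

Import GRing.Theory Num.Theory.
Local Open Scope ring_scope.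

(** Write T_i : V_(D-2) -> V_D for the injective linear map that keeps the letters
    before position i, repeats letter i - 1 at positions i and i + 1, and shifts
    the others by 2 ([lift_mx]).  Its image together with e_i spans the vectors v
    with v_(i-1) = v_(i+1), called flat at i below.  Since T_i maps e_J to
    e_(xi_i J), E_(t_i B) = T_i E_B + <e_i> ([E_of_t_map]).  The canonical
    intervals of t_i B are the xi_i-images of those of B ([canonical_t_map]), so
    v^k_(t_i B) = T_i v^k_B ([v_vec_t_map]), and f^k_(t_i B) is the image of f^k_B
    under [x] |-> [T_i x] + [T_i x + e_i] ([induce_f_elt]).  For B empty,
    f^k is the single vector [w_k].

    The function u-tilde is governed by the walls of v, the x in [1, D + 1] with
    v_(x-1) <> v_x (where v_0 = v_(D+1) = 0): twice u(v) is the sum of (-1)^x over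
    the walls ([u_fun_wall]).  A flip v |-> v + e_i with v flat at i creates or
    destroys two adjacent walls, and T_i inserts no wall and moves walls by 2, so
    both preserve u-tilde.  As u-tilde(w_k) = k, the support of f^k_E lies in the
    level u-tilde = k ([coset_u_tilde]).

    Spanning is by induction on D.  For v flat at i, v = T_i x or T_i x + e_i, and
    [v] + [v + e_i] is induced from [x], hence lies in the span of the f^k_E with
    k = u-tilde(v).  Modulo this span a flip is thus multiplication by -1, and
    flips connect any two vectors of the same level ([flip_connected]): exchanging
    walls and non-walls at the odd places turns flips into transpositions of
    adjacent letters, and the level into the number of letters true.  So every [v]
    of level k is, up to sign, congruent to [w_k] = f^k_0 ([formal_span]).

    Linear independence is by counting.  The relation t_i t_j = t_j t_(i-2) for
    j <= i - 2 ([t_map_comm]) puts every element of S_D in the form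
    t_(i_1) t_(i_2) ... with i_(r+1) >= i_r - 1, and a ballot-type count shows that
    there are at most 2^D pairs (E, k) ([pair_count_total]).  A spanning family of
    at most dim C[V_D] = 2^D vectors is a basis; its part with a given k is then
    free and spans the level k. *)

(** * Supports of vectors *)

Lemma F2_bool (a : 'F_2) : a = (a != 0)%:R.
Proof. by case: a => [[|[|m]] Hm] //; apply/val_inj. Qed.

Lemma F2_natr_neq0 (b : bool) : ((b%:R : 'F_2) != 0) = b.
Proof. by case: b. Qed.

Lemma F2_add_neq0 (a b : 'F_2) : (a + b != 0) = (a != 0) (+) (b != 0).
Proof. by rewrite (F2_bool a) (F2_bool b); case: (a != 0); case: (b != 0). Qed.

Lemma supp_ord (D : nat) (v : 'V_D) (j : 'I_D) : supp v j.+1 = (v 0 j != 0).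
Proof.
apply/existsP/idP => [[l /andP [/eqP [ljE]]]|vj].
  by rewrite (_ : l = j) //; apply/val_inj.
by exists j; rewrite eqxx.
Qed.

Lemma supp_out (D : nat) (v : 'V_D) (x : nat) :
  ~~ (1 <= x <= D)%N -> supp v x = false.
Proof.
move=> xout; apply/existsP => -[j /andP [/eqP xE _]].
by move: xout; rewrite -xE ltn_ord.
Qed.

Lemma supp_inj (D : nat) (v w : 'V_D) : supp v =1 supp w -> v = w.
Proof.
move=> vw; apply/rowP => j.
by rewrite (F2_bool (v 0 j)) (F2_bool (w 0 j)) -!supp_ord vw.
Qed.

Definition vec_of (D : nat) (P : pred nat) : 'V_D := \row_(j < D) (P j.+1)%:R.

Lemma supp_row (D : nat) (v : 'V_D) (P : pred nat) (x : nat) :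
    (forall j : 'I_D, (v 0 j != 0) = P j.+1) ->
  supp v x = (1 <= x <= D)%N && P x.
Proof.
move=> vP; case: (boolP (1 <= x <= D)%N) => [|/supp_out-> //].
by case: x => // x xD; rewrite (supp_ord v (Ordinal xD)) vP.
Qed.

Lemma supp_vec_of (D : nat) (P : pred nat) (x : nat) :
  supp (vec_of D P) x = (1 <= x <= D)%N && P x.
Proof. by apply: supp_row => j; rewrite mxE F2_natr_neq0. Qed.

Lemma suppD (D : nat) (v w : 'V_D) (x : nat) :
  supp (v + w) x = supp v x (+) supp w x.
Proof.
case: (boolP (1 <= x <= D)%N) => [|xout]; last by rewrite !supp_out.
by case: x => // x xD; rewrite !(supp_ord _ (Ordinal xD)) mxE F2_add_neq0.
Qed.

Lemma supp0 (D : nat) (x : nat) : supp (0 : 'V_D) x = false.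
Proof. by apply/existsP => -[j]; rewrite mxE eqxx andbF. Qed.

Lemma supp_e_vec (D i x : nat) :
  supp (e_vec D i) x = (1 <= x <= D)%N && (x == i).
Proof. by apply: (supp_row (P := pred1 i)) => j; rewrite mxE F2_natr_neq0. Qed.

Lemma supp_e_intv (D : nat) (J : intv) (x : nat) :
  supp (e_intv D J) x = (1 <= x <= D)%N && in_intv x J.
Proof.
apply: (supp_row (P := in_intv^~ J)) => j; rewrite /e_intv summxE /in_intv.
under eq_bigr => i _ do rewrite mxE.
have [jin|jout] := boolP (J.1 <= j.+1 <= J.2)%N; last first.
  rewrite big_nat_cond big1 ?eqxx // => i /andP[iJ _].
  by case: eqP => // ji; move: jout; rewrite ji -ltnS iJ.
rewrite (bigD1_seq j.+1) ?iota_uniq ?mem_index_iota //= eqxx big1 // => i.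
by rewrite eq_sym => /negbTE->.
Qed.

Lemma e_intv1 (D i : nat) : e_intv D (i, i) = e_vec D i.
Proof. by rewrite /e_intv /= big_nat1. Qed.

(** * The maps T_i *)

(** The position of V_(D-2) from which position y of V_D takes its letter under T_i;
    position i - 1 feeds i - 1, i and i + 1. *)
Definition collapse (i y : nat) : nat :=
  if (y < i)%N then y else if (y == i)%N then i.-1 else (y - 2)%N.

(** The matrix of T_i, acting on row vectors. *)
Definition lift_mx (D i : nat) : 'M['F_2]_(D, D.+2) :=
  \matrix_(j, l) (collapse i l.+1 == j.+1)%:R.

Lemma supp_lift (D i : nat) (v : 'V_D) (x : nat) :
  supp (v *m lift_mx D i) x = (1 <= x <= D.+2)%N && supp v (collapse i x).
Proof.
apply: (supp_row (P := fun x => supp v (collapse i x))) => l.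
rewrite mxE; set y := collapse i l.+1.
case: (boolP (1 <= y <= D)%N) => yin; last first.
  rewrite supp_out // big1 ?eqxx // => j _; rewrite mxE -/y.
  case: eqP => [yE|_]; last by rewrite mulr0.
  by move: yin; rewrite yE ltn_ord.
case yE: y yin => [|z] // zD.
rewrite (supp_ord v (Ordinal zD)) (bigD1 (Ordinal zD)) //= big1 ?addr0.
  by rewrite mxE -/y yE eqxx mulr1.
move=> j jy; rewrite mxE -/y yE eqSS; case: eqP => [yj|_]; last by rewrite mulr0.
by case/eqP: jy; apply/val_inj.
Qed.

Definition in_range (D : nat) (J : intv) : bool := (1 <= J.1 <= J.2)%N && (J.2 <= D)%N.

(** The indicator of an interval J is lengthened by 2 exactly when J contains i - 1,
    which is the stretching case of xi_i. *)
Lemma e_intv_xi (D i : nat) (J : intv) : in_range D J ->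
  (1 <= i <= D.+2)%N -> e_intv D.+2 (xi i J) = e_intv D J *m lift_mx D i.
Proof.
case: J => a b Jr iD; apply: supp_inj => x.
rewrite supp_lift !supp_e_intv; move: Jr; rewrite /in_range /in_intv /xi /collapse /=.
by case: (leqP i a) => ?; case: (leqP (b + 2) i) => ? /=;
  case: (ltngtP x i) => ? /=; lia.
Qed.

(** * The operations t_i on families of intervals *)

Lemma xi_inj (i : nat) : injective (xi i).
Proof.
case=> a b [c d]; rewrite /xi /=.
by case: (leqP i a) => ?; case: (leqP (b + 2) i) => ?;
  case: (leqP i c) => ?; case: (leqP (d + 2) i) => ? [? ?];
  congr pair; lia.
Qed.

(** The left end of xi_i J is never i, so the union in the definition of t_i is
    disjoint. *)
Lemma xi_neq (i : nat) (J : intv) : xi i J != (i, i).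
Proof.
case: J => a b; rewrite /xi /=.
by case: (leqP i a) => ?; case: (leqP (b + 2) i) => ?; rewrite xpair_eqE; lia.
Qed.

Variant xi_spec (i a b : nat) : intv -> Type :=
  | XiShift of (i <= a)%N : xi_spec i a b (a + 2, b + 2)%N
  | XiId of (a < i)%N & (b + 2 <= i)%N : xi_spec i a b (a, b)
  | XiStretch of (a < i)%N & (i < b + 2)%N : xi_spec i a b (a, b + 2)%N.

Lemma xiP (i a b : nat) : xi_spec i a b (xi i (a, b)).
Proof.
rewrite /xi /=; case: leqP => ia; first by constructor.
by case: leqP => bi; constructor.
Qed.

Lemma xi_comm (i j : nat) (J : intv) : (j + 2 <= i)%N ->
  xi i (xi j J) = xi j (xi (i - 2) J).
Proof.
case: J => a b ji.
case: (xiP j a b) => *; case: (xiP (i - 2) a b) => *; try lia;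
  case: xiP => *; try lia; case: xiP => *; try lia; congr pair; lia.
Qed.

Lemma t_mapP (i : nat) (B : {fset intv}) (J : intv) :
  reflect (J = (i, i) \/ exists2 I, I \in B & J = xi i I) (J \in t_map i B).
Proof.
rewrite /t_map in_fsetU in_fset1 orbC.
apply: (iffP orP) => [[/eqP->|/imfsetP [I IB ->]]|[->|[I IB ->]]].
- by left.
- by right; exists I.
- by left.
- by right; apply/imfsetP; exists I.
Qed.

Lemma t_map_self (i : nat) (B : {fset intv}) : (i, i) \in t_map i B.
Proof. by apply/t_mapP; left. Qed.

Lemma t_map_xi (i : nat) (B : {fset intv}) (J : intv) :
  (xi i J \in t_map i B) = (J \in B).
Proof.
apply/t_mapP/idP => [[/eqP|[I IB /xi_inj->//]]|JB]; last by right; exists J.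
by rewrite (negbTE (xi_neq i J)).
Qed.

Lemma card_t_map (i : nat) (B : {fset intv}) : #|` t_map i B| = #|` B|.+1.
Proof.
rewrite /t_map fsetUC cardfsU1 card_imfset; last exact: xi_inj.
suff -> : (i, i) \notin [fset xi i J | J in B]%fset by [].
by apply/imfsetP => -[J _ /eqP]; rewrite eq_sym (negbTE (xi_neq i J)).
Qed.

Lemma xi_point (i j : nat) : (j + 2 <= i)%N -> xi i (j, j) = (j, j).
Proof. by move=> ji; rewrite /xi /= ji ifF //; lia. Qed.

(** Far insertions commute, up to the shift caused by the one on the left.  This
    yields both the factorisation through any singleton of B and the normal forms
    used for counting. *)
Lemma t_map_comm (i j : nat) (B : {fset intv}) : (j + 2 <= i)%N ->
  t_map i (t_map j B) = t_map j (t_map (i - 2) B).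
Proof.
move=> ji; have xij : xi j (i - 2, i - 2)%N = (i, i).
  by rewrite /xi /= ifT; [congr pair|]; lia.
apply/fsetP => J; apply/t_mapP/t_mapP.
  case=> [->|[I /t_mapP [->|[K KB ->]] ->]].
  - by right; exists (i - 2, i - 2)%N; rewrite ?t_map_self ?xij.
  - by left; rewrite xi_point.
  - by right; exists (xi (i - 2) K); rewrite ?t_map_xi // xi_comm.
case=> [->|[I /t_mapP [->|[K KB ->]] ->]].
- by right; exists (j, j); rewrite ?t_map_self ?xi_point.
- by left; rewrite xij.
- by right; exists (xi j K); rewrite ?t_map_xi // [RHS]xi_comm.
Qed.

Lemma S_setP (D : nat) (B : {fset intv}) :
  reflect
    (B = fset0 \/
     exists i C, [/\ (1 <= i <= D.+2)%N, C \in S_set D & B = t_map i C])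
    (B \in S_set D.+2).
Proof.
rewrite /= in_fsetU in_fset1.
apply: (iffP orP) => [[/eqP->|/imfset2P [i iD [C CS ->]]]|[->|[i [C [iD CS ->]]]]].
- by left.
- right; exists i, C; split=> //.
  by move: (iD : i \in iota 1 D.+2); rewrite mem_iota add1n ltnS.
- by left.
right; apply/imfset2P; exists i; last by exists C.
by change (i \in iota 1 D.+2); rewrite mem_iota add1n ltnS.
Qed.

Lemma S_set_ind (P : nat -> {fset intv} -> Prop) :
    (forall D, P D fset0) ->
    (forall D i B, (1 <= i <= D.+2)%N -> B \in S_set D -> P D B ->
       P D.+2 (t_map i B)) ->
  forall D B, B \in S_set D -> P D B.
Proof.
move=> P0 Pt D; move: {2}D (leqnn D) => n; elim: n D => [|n IHn] [|[|D]] // Dn B.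
all: try by rewrite inE => /eqP->.
case/S_setP => [->//|[i [C [iD CS ->]]]].
by apply: Pt => //; apply: IHn => //; lia.
Qed.

Lemma S_set0 (D : nat) : fset0 \in S_set D.
Proof. by case: D => [|[|D]]; rewrite ?inE //; apply/S_setP; left. Qed.

Lemma S_set_t (D i : nat) (B : {fset intv}) : (1 <= i <= D.+2)%N ->
  B \in S_set D -> t_map i B \in S_set D.+2.
Proof. by move=> iD BS; apply/S_setP; right; exists i, B. Qed.

Lemma xi_range (D i : nat) (J : intv) : (1 <= i <= D.+2)%N -> in_range D J ->
  in_range D.+2 (xi i J).
Proof.
case: J => a b; rewrite /in_range /xi /=.
by case: (leqP i a) => ?; case: (leqP (b + 2) i) => ? /=; lia.
Qed.

Lemma S_range (D : nat) (B : {fset intv}) : B \in S_set D ->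
  {in B, forall J, in_range D J}.
Proof.
move: D B; apply: S_set_ind => [D J|D i B iD _ IH J]; first by rewrite inE.
case/t_mapP => [->|[I IB ->]]; first by rewrite /in_range /=; lia.
by apply: xi_range => //; apply: IH.
Qed.

(** Only shifts and identities produce singletons: stretching gives length at least 3. *)
Lemma xi_eq_point (j i : nat) (J : intv) : (J.1 <= J.2)%N -> xi j J = (i, i) ->
  exists2 l, J = (l, l) &
    (j <= l)%N /\ i = (l + 2)%N \/ (l + 2 <= j)%N /\ i = l.
Proof.
case: J => a b /= ab; rewrite /xi /=.
case: (leqP j a) => ?; [|case: (leqP (b + 2) j) => ?] => -[? ?].
- by exists a; [congr pair|]; lia.
- by exists a; [congr pair|]; lia.
- by lia.
Qed.

(** A singleton [i, i] of B that was not inserted last comes from a singleton of the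
    previous family; by induction that one may be inserted last there, and then the
    two insertions are exchanged. *)
Lemma S_set_factor (D i : nat) (B : {fset intv}) : B \in S_set D.+2 ->
  (i, i) \in B -> exists2 C, C \in S_set D & B = t_map i C.
Proof.
elim/ltn_ind: D i B => D IH i B /S_setP [->|[j [C [jD CS ->]]]].
  by rewrite inE.
case/t_mapP => [[->]|[J JC /esym]]; first by exists C.
have /andP[/andP[J1 J12] J2] := S_range CS JC.
case/(xi_eq_point J12) => l Jl lji; rewrite {}Jl /= in JC J1 J12 J2.
case: D IH CS jD J2 => [|[|D]] IH CS jD J2; try by move: CS JC; rewrite inE => /eqP->.
have [C' C'S CE] := IH D (ltnW (ltnSn _)) l C CS JC.
case: lji => -[jl ->]; rewrite {}CE.
  exists (t_map j C'); first by apply: S_set_t => //; lia.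
  by rewrite (@t_map_comm (l + 2)) ?addnK //; lia.
exists (t_map (j - 2) C'); first by apply: S_set_t => //; lia.
by rewrite t_map_comm.
Qed.

(** * Contraction at i *)

(** The section of [collapse] that avoids i and i + 1. *)
Definition expand (i y : nat) : nat := if (y < i)%N then y else (y + 2)%N.

(** A common left inverse of T_i and T_i + e_i. *)
Definition contract (D i : nat) (v : 'V_D.+2) : 'V_D :=
  vec_of D (fun y => supp v (expand i y)).

Lemma lift_mxK (D i : nat) (x : 'V_D) : (1 <= i <= D.+2)%N ->
  contract i (x *m lift_mx D i) = x.
Proof.
move=> iD; apply: supp_inj => y; rewrite supp_vec_of.
case: (boolP (1 <= y <= D)%N) => [yD|/supp_out-> //].
rewrite supp_lift /expand /collapse; case: (ltnP y i) => yi /=.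
  by rewrite yi; have -> : (0 < y <= D.+2)%N by lia.
rewrite ifF; last by lia.
by rewrite ifF ?addnK; last lia; have -> : (0 < y + 2 <= D.+2)%N by lia.
Qed.

Lemma lift_mxKe (D i : nat) (x : 'V_D) : (1 <= i <= D.+2)%N ->
  contract i (x *m lift_mx D i + e_vec D.+2 i) = x.
Proof.
move=> iD; rewrite -[RHS](lift_mxK x iD); apply: supp_inj => y.
rewrite !supp_vec_of suppD supp_e_vec (_ : expand i y == i = false) ?andbF ?addbF //.
by rewrite /expand; case: ltnP; lia.
Qed.

(** Both neighbours of i carry letter i - 1 of x; for i = D + 2 both are 0. *)
Lemma lift_flat (D i : nat) (x : 'V_D) : (1 <= i <= D.+2)%N ->
  supp (x *m lift_mx D i) i.-1 = supp (x *m lift_mx D i) i.+1.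
Proof.
move=> iD; rewrite !supp_lift /collapse.
have -> : (i.-1 < i)%N by lia.
have -> : (i.+1 < i)%N = false by lia.
have -> : (i.+1 == i) = false by lia.
have -> : (i.+1 - 2 = i.-1)%N by lia.
case: (boolP (1 <= i.-1 <= D)%N) => [iD'|/supp_out->]; last by rewrite !andbF.
by congr andb; lia.
Qed.

(** The letters of a vector flat at i outside position i are those of T_i of its
    contraction, so that only the letter at i is free. *)
Lemma contractK (D i : nat) (v : 'V_D.+2) : (1 <= i <= D.+2)%N ->
    supp v i.-1 = supp v i.+1 ->
  v = contract i v *m lift_mx D i \/ v = contract i v *m lift_mx D i + e_vec D.+2 i.
Proof.
move=> iD vi.
have off x : x != i -> supp (contract i v *m lift_mx D i) x = supp v x.
  move=> xi; rewrite supp_lift supp_vec_of /expand /collapse.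
  case: (boolP (1 <= x <= D.+2)%N) => [xD|/supp_out->//] /=.
  case: (ltngtP x i) xi => [xi _|xi _|//].
    rewrite xi; case: (boolP (1 <= x <= D)%N) => //= xD'.
    have -> : x = i.-1 by lia.
    by rewrite vi supp_out //; lia.
  case: (ltnP (x - 2)%N i) => xi'; last first.
    have -> : (x - 2 + 2 = x)%N by lia.
    by have -> : (0 < x - 2 <= D)%N by lia.
  have xE : x = i.+1 by lia.
  have -> : (x - 2 = i.-1)%N by lia.
  rewrite vi xE; case: (boolP (0 < i.-1 <= D)%N) => //= i1.
  by rewrite -vi supp_out //; lia.
case: (boolP (supp (contract i v *m lift_mx D i) i == supp v i)) => [/eqP vii|vii].
  left; apply: supp_inj => x; case: (eqVneq x i) => [->//|xi].
  by rewrite off.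
right; apply: supp_inj => x; rewrite suppD supp_e_vec.
case: (eqVneq x i) => [->|xi]; last by rewrite andbF addbF off.
by rewrite iD /=; case: (supp v i) vii; case: (supp _ _).
Qed.

Definition lift_hom (D i : nat) : 'Hom('V_D, 'V_D.+2) :=
  linfun (mulmxr (lift_mx D i)).

Lemma lift_homE (D i : nat) (x : 'V_D) : lift_hom D i x = x *m lift_mx D i.
Proof. by rewrite lfunE. Qed.

(** * The subspaces E_B *)

Lemma E_of_t_map (D i : nat) (B : {fset intv}) : (1 <= i <= D.+2)%N ->
    {in B, forall J, in_range D J} ->
  E_of D.+2 (t_map i B) = (lift_hom D i @: E_of D B + <[e_vec D.+2 i]>)%VS.
Proof.
move=> iD Br; rewrite /E_of limg_span addvC -span_cons; apply: eq_span => v.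
rewrite in_cons -map_comp; apply/mapP/orP.
  case=> J /t_mapP [->|[I IB ->]] ->; first by left; rewrite e_intv1.
  right; apply/mapP; exists I => //.
  by rewrite /= lift_homE e_intv_xi //; apply: Br.
case=> [/eqP->|/mapP [I IB ->]].
  by exists (i, i); rewrite ?e_intv1 //; exact: t_map_self.
exists (xi i I); first by rewrite t_map_xi.
by rewrite /= lift_homE e_intv_xi //; apply: Br.
Qed.

Lemma F2_cases (c : 'F_2) : c = 0 \/ c = 1.
Proof. by rewrite (F2_bool c); case: (c != 0); [right|left]. Qed.

Lemma mem_E_t_map (D i : nat) (B : {fset intv}) (v : 'V_D.+2) : (1 <= i <= D.+2)%N ->
    {in B, forall J, in_range D J} ->
  v \in E_of D.+2 (t_map i B) <->
  exists2 x, x \in E_of D B &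
    v = x *m lift_mx D i \/ v = x *m lift_mx D i + e_vec D.+2 i.
Proof.
move=> iD Br; rewrite E_of_t_map //; split.
  case/memv_addP => _ /memv_imgP [x xE ->] [_ /vlineP [c ->] ->].
  exists x => //; rewrite lift_homE.
  by case: (F2_cases c) => ->; [left; rewrite scale0r addr0|right; rewrite scale1r].
have ME x : x \in E_of D B -> x *m lift_mx D i \in (lift_hom D i @: E_of D B)%VS.
  by move=> xE; rewrite -lift_homE memv_img.
case=> x /ME xE [->|->]; first by rewrite -[x *m _]addr0 memv_add ?mem0v.
by rewrite memv_add ?memv_line.
Qed.

Lemma e_vec_lift_neq (D i : nat) (x : 'V_D) : (1 <= i <= D.+2)%N ->
  x *m lift_mx D i != e_vec D.+2 i.
Proof.
move=> iD; apply/eqP => xe; have := lift_mxK x iD; rewrite xe => x0.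
have: supp (x *m lift_mx D i) i = true by rewrite xe supp_e_vec iD eqxx.
rewrite -x0 supp_lift supp_vec_of supp_e_vec => /andP [_ /andP [_ /andP [_]]].
by rewrite /expand; case: ifP; lia.
Qed.

Lemma dim_E_of (D : nat) (B : {fset intv}) : B \in S_set D ->
  \dim (E_of D B) = #|` B|.
Proof.
move: D B; apply: S_set_ind => [D|D i B iD BS IH].
  by rewrite cardfs0 /E_of span_nil dimv0.
have injM : injective (lift_hom D i).
  by move=> x y; rewrite !lift_homE => /(congr1 (contract i)); rewrite !lift_mxK.
rewrite E_of_t_map //; last exact: S_range BS.
have -> : \dim (lift_hom D i @: E_of D B + <[e_vec D.+2 i]>)
    = (\dim (lift_hom D i @: E_of D B) + \dim <[e_vec D.+2 i]>)%N.
  apply: dimv_disjoint_sum; apply/eqP; rewrite -subv0; apply/subvP => v.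
  rewrite memv_cap => /andP [/memv_imgP [x _ ->] /vlineP [c]].
  rewrite lift_homE; case: (F2_cases c) => ->.
    by rewrite scale0r => ->; rewrite mem0v.
  by rewrite scale1r => /eqP; rewrite (negbTE (e_vec_lift_neq _ _)).
rewrite limg_dim_eq ?IH ?card_t_map; last first.
  by rewrite (eqP (_ : lker _ == 0%VS)) ?capv0 //; apply/lker0P.
rewrite dim_vline; suff -> : e_vec D.+2 i != 0 by rewrite addn1.
apply/eqP => /(congr1 (fun v => supp v i)).
by rewrite supp_e_vec supp0 iD eqxx.
Qed.

(** An insertion e_j cannot help to produce another e_i: T_j x and T_j x + e_j are
    flat at j, which forces i away from j - 1 and j + 1, and contracting at j reduces
    e_i to a basis vector of E of the previous family. *)
Lemma e_vec_mem_E (D i : nat) (B : {fset intv}) : B \in S_set D ->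
  (1 <= i <= D)%N -> e_vec D i \in E_of D B -> (i, i) \in B.
Proof.
move=> BS; move: D B BS i; apply: S_set_ind => [D i iD|D j B jD BS IH i iD].
  rewrite /E_of span_nil memv0 => /eqP /(congr1 (fun v => supp v i)).
  by rewrite supp_e_vec supp0 iD eqxx.
rewrite mem_E_t_map //; last exact: S_range BS.
case=> x xE ex; case: (eqVneq i j) => [->|ij]; first exact: t_map_self.
have ix : contract j (e_vec D.+2 i) = x by case: ex => ->; rewrite ?lift_mxK ?lift_mxKe.
have flat : supp (e_vec D.+2 i) j.-1 = supp (e_vec D.+2 i) j.+1.
  case: ex => ->; rewrite ?suppD (lift_flat _ jD) //.
  by rewrite !supp_e_vec; congr addb; lia.
move: flat; rewrite !supp_e_vec => flat.
have [i1 i2] : i != j.-1 /\ i != j.+1.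
  by split; apply/eqP => iE; subst i; move: flat; rewrite eqxx; lia.
(* The place l of V_D that insertion at j moves to i. *)
pose l := if (i < j)%N then i else (i - 2)%N.
have lr : (1 <= l <= D)%N by rewrite /l; case: (ltnP i j) => ?; lia.
have xl : x = e_vec D l.
  rewrite -ix; apply: supp_inj => y; rewrite supp_vec_of !supp_e_vec.
  rewrite /l /expand; case: (boolP (1 <= y <= D)%N) => //= yD.
  by case: (ltnP y j) => ?; case: (ltnP i j) => ?; lia.
have -> : (i, i) = xi j (l, l).
  rewrite /l /xi /=; case: (ltnP i j) => ?; [rewrite ifF ?ifT//|rewrite ifT]; try lia.
  by congr pair; lia.
by rewrite t_map_xi; apply: IH => //; rewrite -xl.
Qed.

(** If e_i is in E_B = E_C, then [i, i] is in B and in C, both factor through t_i, and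
    contraction at i reduces the claim to smaller D. *)
Lemma E_of_inj (D : nat) : {in S_set D &, injective (E_of D)}.
Proof.
move=> B C BS; move: D B BS C; apply: S_set_ind => [D C CS|D i B iD BS IH C CS] EE.
  apply/esym/eqP/negPn/negP => /fset0Pn [J JC].
  have /andP[/andP[J1 J12] J2] := S_range CS JC.
  have: e_intv D J \in E_of D C by apply/memv_span/mapP; exists J.
  rewrite -EE /E_of span_nil memv0 => /eqP /(congr1 (fun v => supp v J.1)).
  by rewrite supp_e_intv supp0 /in_intv J1 leqnn J12 (leq_trans J12 J2).
have eC : e_vec D.+2 i \in E_of D.+2 C.
  by rewrite -EE E_of_t_map ?(subvP (addvSr _ _)) ?memv_line //; exact: S_range BS.
have [C' C'S CE] := S_set_factor CS (e_vec_mem_E CS iD eC).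
rewrite {C eC}CE in CS EE *; congr t_map; apply: IH => //.
have Br := S_range BS; have C'r := S_range C'S.
apply/vspaceP => x; apply/idP/idP => xE.
  have: x *m lift_mx D i \in E_of D.+2 (t_map i B).
    by apply/mem_E_t_map => //; exists x; [|left].
  rewrite EE => /mem_E_t_map [] // y yE xy.
  suff -> : x = y by [].
  by rewrite -[LHS](lift_mxK x iD); case: xy => ->; rewrite ?lift_mxK ?lift_mxKe.
have: x *m lift_mx D i \in E_of D.+2 (t_map i C').
  by apply/mem_E_t_map => //; exists x; [|left].
rewrite -EE => /mem_E_t_map [] // y yE xy.
suff -> : x = y by [].
by rewrite -[LHS](lift_mxK x iD); case: xy => ->; rewrite ?lift_mxK ?lift_mxKe.
Qed.

(** By injectivity the list searched by [B_of] contains no family but B. *)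
Lemma B_of_E_of (D : nat) (B : {fset intv}) : B \in S_set D -> B_of (E_of D B) = B.
Proof.
move=> BS; rewrite /B_of.
have: B \in [seq C <- S_set D | E_of D C == E_of D B] by rewrite mem_filter eqxx.
case E: (filter _ _) => [//|C s] _ /=.
have: C \in [seq C <- S_set D | E_of D C == E_of D B] by rewrite E mem_head.
by rewrite mem_filter => /andP [/eqP EE CS]; apply: (E_of_inj CS BS EE).
Qed.

(** * Canonical intervals as gaps between cuts *)

Definition starts (P : pred nat) (n : nat) : seq nat :=
  [seq x <- iota 1 n | P x && ~~ P x.-1].

Definition stops (P : pred nat) (n : nat) : seq nat :=
  [seq x <- iota 1 n | ~~ P x && P x.-1].

(** The places x between two consecutive uncovered positions x and x + 1, where 0 and
    D + 1 count as uncovered.  The canonical intervals are exactly the stretches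
    [c + 1, c'] between consecutive cuts c < c': a stretch inside a gap is a singleton,
    and one that bridges two wide gaps is a joining interval. *)
Definition cuts (P : pred nat) (n : nat) : seq nat :=
  [seq x <- iota 0 n | ~~ P x && ~~ P x.+1].

(** The cuts inside the gap between b = g.1 - 1 and a = g.2. *)
Definition gap_cuts (g : nat * nat) : seq nat := index_iota g.1 g.2.-1.

Lemma filter_iotaS (Q : pred nat) (m n : nat) :
  [seq x <- iota m n.+1 | Q x] =
  [seq x <- iota m n | Q x] ++ (if Q (m + n)%N then [:: (m + n)%N] else [::]).
Proof. by rewrite -addn1 iotaD filter_cat. Qed.

(** Scanning from left to right, [starts] is one ahead of [stops] inside a run.  The
    open gap is closed provisionally at n + 1, so that its cuts are those below n. *)
Lemma gaps_scan (P : pred nat) (n : nat) : P 0%N = false ->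
  if P n then
    size (starts P n) = (size (stops P n)).+1 /\
    flatten [seq gap_cuts g | g <- zip (0%N :: stops P n) (starts P n)] = cuts P n
  else
    size (starts P n) = size (stops P n) /\
    flatten [seq gap_cuts g
            | g <- zip (0%N :: stops P n) (rcons (starts P n) n.+1)] = cuts P n.
Proof.
move=> P0; elim: n => [|n]; first by rewrite P0.
rewrite /starts /stops /cuts !filter_iotaS !add1n !add0n /=.
case Pn : (P n) => /=; case Pn1 : (P n.+1) => /=; rewrite ?cats0 // => -[sz fl].
- rewrite cats1 size_rcons -sz; split=> //.
  rewrite -rcons_cons zip_rcons ?map_rcons ?flatten_rcons ?fl; last by rewrite sz.
  by rewrite /gap_cuts /index_iota /= subnn cats0.
- by rewrite cats1 size_rcons sz.
- split=> //; rewrite -fl !(lastI 0%N) !zip_rcons ?size_belast //.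
  rewrite !map_rcons !flatten_rcons -catA; congr cat; rewrite /gap_cuts /=.
  set l := last _ _; have ln : (l <= n)%N.
    have: l \in 0%N :: stops P n by apply: mem_last.
    by rewrite in_cons mem_filter mem_iota add1n ltnS => /predU1P [->//|/and3P []].
  by rewrite /index_iota subSn // -addn1 iotaD subnKC.
Qed.

Lemma stops_shift (P : pred nat) (n : nat) : P 0%N = false ->
  stops P n.+1 = [seq x.+1 | x <- iota 1 n & P x && ~~ P x.+1].
Proof.
move=> P0; rewrite /stops /= P0 andbF -[2%N]/(1 + 1)%N iotaDl filter_map.
by congr map; apply: eq_filter => x /=; rewrite add1n andbC.
Qed.

Lemma starts_out (P : pred nat) (n : nat) : P n.+1 = false ->
  starts P n.+1 = starts P n.
Proof. by move=> Pn; rewrite /starts filter_iotaS add1n Pn cats0. Qed.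

Section Runs.

Variables (D : nat) (P : pred nat).
Hypotheses (P0 : P 0%N = false) (PD : P D.+1 = false).

Lemma size_runs :
  size [seq x <- iota 1 D | P x && ~~ P x.-1] =
  size [seq x <- iota 1 D | P x && ~~ P x.+1].
Proof.
have := @gaps_scan P D.+1 P0; rewrite PD => -[+ _].
by rewrite starts_out // stops_shift // size_map.
Qed.

Lemma runs_starts : [seq J.1 | J <- runs D P] = starts P D.
Proof. by rewrite [LHS]unzip1_zip // size_runs. Qed.

Lemma runs_stops : [seq J.2.+1 | J <- runs D P] = stops P D.+1.
Proof.
rewrite stops_shift // (map_comp S snd) [map snd _]unzip2_zip //.
by rewrite size_runs.
Qed.

End Runs.

(** The gaps, read from left to right, list all cuts. *)
Lemma gaps_cuts (D : nat) (B : {fset intv}) : {in B, forall J, in_range D J} ->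
  flatten [seq gap_cuts g | g <- gaps D B] = cuts (union_intv B) D.+1.
Proof.
move=> Br.
have out x : ~~ (1 <= x <= D)%N -> union_intv B x = false.
  move=> xD; apply/hasP => -[J JB]; move: (Br J JB).
  by rewrite /in_range /in_intv; lia.
have U0 : union_intv B 0%N = false by apply: out.
have UD : union_intv B D.+1 = false by apply: out; lia.
rewrite /gaps runs_starts // runs_stops //.
by have := @gaps_scan _ D.+1 U0; rewrite UD starts_out // => -[].
Qed.

(** The stretches [c + 1, c'] between consecutive entries c, c' of s. *)
Definition consec (s : seq nat) : seq intv := zip (map S s) (behead s).

Lemma consec_cat (x y : nat) (s t : seq nat) :
  consec (x :: s ++ y :: t) = consec (x :: s) ++ ((last x s).+1, y) :: consec (y :: t).
Proof.
elim: s x => [//|z s IH] x; rewrite cat_cons.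
by rewrite -[consec (x :: _)]/((x.+1, z) :: consec (z :: s ++ y :: t)) IH.
Qed.

Lemma consec_iota (x n : nat) : consec (iota x n.+1) = [seq (j, j) | j <- iota x.+1 n].
Proof.
by elim: n x => [//|n IH] x; apply: (congr1 (cons _) (IH x.+1)).
Qed.

Lemma last_iota (x n : nat) : last x (iota x.+1 n) = (x + n)%N.
Proof. by elim: n x => [|n IH] x /=; rewrite ?addn0 // IH addSnnS. Qed.

Definition wide (g : nat * nat) : bool := (g.1 + 2 <= g.2)%N.

(** A gap with a single uncovered position has no cut. *)
Lemma gap_cuts_wide (g : seq (nat * nat)) :
  flatten [seq gap_cuts h | h <- g] = flatten [seq gap_cuts h | h <- g & wide h].
Proof.
elim: g => //= h g ->; case: ifP => //=; rewrite /wide /gap_cuts /index_iota => hw.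
by have -> : (h.2.-1 - h.1 = 0)%N by lia.
Qed.

(** Within one wide gap the stretches between cuts are singletons; from the last cut
    of a wide gap to the first cut of the next wide gap runs a joining interval. *)
Lemma canonical_perm (h : seq (nat * nat)) : all wide h ->
  perm_eq ([seq (p.1.2.-1, p.2.1) | p <- zip h (behead h)] ++
           [seq (j, j) | g <- [seq g <- h | (g.1 + 3 <= g.2)%N],
                         j <- index_iota g.1.+1 g.2.-1])
    (consec (flatten [seq gap_cuts g | g <- h])).
Proof.
elim: h => [//|g h IH] /= /andP [gw hw]; have {}IH := IH hw.
have gE : gap_cuts g = g.1 :: index_iota g.1.+1 g.2.-1.
  rewrite /gap_cuts /index_iota; move: gw; rewrite /wide => gw.
  by have -> : (g.2.-1 - g.1 = (g.2.-1 - g.1.+1).+1)%N by lia.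
have gC : consec (gap_cuts g) = [seq (j, j) | j <- index_iota g.1.+1 g.2.-1].
  by rewrite gE -[_ :: _]/(iota g.1 _.+1) consec_iota.
have -> : [seq (j, j) | g <- (if (g.1 + 3 <= g.2)%N
                              then g :: [seq g <- h | (g.1 + 3 <= g.2)%N]
                              else [seq g <- h | (g.1 + 3 <= g.2)%N]),
                        j <- index_iota g.1.+1 g.2.-1] =
   consec (gap_cuts g) ++ [seq (j, j) | g <- [seq g <- h | (g.1 + 3 <= g.2)%N],
                         j <- index_iota g.1.+1 g.2.-1].
  rewrite gC; case: ifP => // g3; rewrite /index_iota.
  by have -> : (g.2.-1 - g.1.+1 = 0)%N by lia.
have lastg : (last g.1 (index_iota g.1.+1 g.2.-1)).+1 = g.2.-1.
  by rewrite /index_iota last_iota; move: gw; rewrite /wide; lia.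
case: h hw IH => [|g' h] /=; first by rewrite !cats0.
move=> /andP [gw' _] IH.
have [s sE] : exists s, gap_cuts g' = g'.1 :: s.
  move: gw'; rewrite /wide /gap_cuts /index_iota.
  by case E : (g'.2.-1 - g'.1)%N => [|m] g2; [lia|exists (iota g'.1.+1 m)].
rewrite sE cat_cons gE consec_cat lastg -gE -[g'.1 :: s ++ _]cat_cons -sE.
by rewrite -cat_cons perm_catCA perm_cat2l cat_cons perm_cons.
Qed.

Lemma consec_sub (s : seq nat) (J : intv) : J \in consec s ->
  exists2 i, (i.+1 < size s)%N & J = ((nth 0%N s i).+1, nth 0%N s i.+1).
Proof.
case/(nthP (0, 0)%N) => i; rewrite size_zip size_map size_behead => iS <-.
have i1S : (i.+1 < size s)%N.
  by move: iS; rewrite leq_min => /andP [_]; case: (size s).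
exists i => //; rewrite nth_zip_cond size_zip size_map size_behead iS.
rewrite (nth_map 0%N); last exact: ltnW.
by rewrite nth_behead.
Qed.

Lemma consec_sorted (s : seq nat) : sorted ltn s ->
  sorted (fun J K : intv => (J.1 <= K.1)%N) (consec s).
Proof.
case: s => // x s; elim: s x => // y s IH x /= /andP [xy ys].
move: (IH y ys); case: s {IH} ys => //= z s /andP [_ _] ->.
by rewrite ltnS ltnW.
Qed.

Lemma cuts_sorted (P : pred nat) (n : nat) : sorted ltn (cuts P n).
Proof. by apply: sorted_filter (iota_ltn_sorted _ _); apply: ltn_trans. Qed.

(** The left ends of the stretches are distinct, so sorting by left end leaves no
    choice and both lists agree once they are permutations of each other. *)
Lemma canonical_cuts (D : nat) (B : {fset intv}) : {in B, forall J, in_range D J} ->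
  canonical_intervals D B = consec (cuts (union_intv B) D.+1).
Proof.
move=> Br; rewrite /canonical_intervals.
set leI := (fun J K : intv => _); set c := consec _.
have leI_tr : transitive leI by move=> J I K; apply: leq_trans.
have cE : sort leI c = c.
  by apply: (sorted_sort leI_tr); apply: consec_sorted; apply: cuts_sorted.
have pm : perm_eq c (joining_intervals D B ++ singleton_intervals D B).
  rewrite perm_sym /c -gaps_cuts // gap_cuts_wide.
  rewrite /joining_intervals /singleton_intervals /wide_gaps.
  rewrite -[[seq g <- gaps D B | (g.1 + 2 <= g.2)%N]]/(filter wide (gaps D B)).
  have -> : [seq g <- gaps D B | (g.1 + 3 <= g.2)%N]
      = [seq g <- filter wide (gaps D B) | (g.1 + 3 <= g.2)%N].
    by rewrite -filter_predI; apply: eq_filter => g /=; rewrite /wide; lia.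
  by apply: canonical_perm; apply: filter_all.
rewrite -[RHS]cE; apply/esym/(perm_sort_inP _ _ _ _ pm).
- by move=> J K _ _; apply: leq_total.
- by move=> J I K _ _ _; apply: leI_tr.
move=> J K /consec_sub [i iS ->] /consec_sub [j jS ->] /anti_leq [/eqP].
have uc : uniq (cuts (union_intv B) D.+1).
  by rewrite filter_uniq ?iota_uniq.
by rewrite nth_uniq // ?(ltnW iS) ?(ltnW jS) // => /eqP->.
Qed.

Lemma canonical_range (D : nat) (B : {fset intv}) (J : intv) :
  {in B, forall J, in_range D J} -> J \in canonical_intervals D B -> in_range D J.
Proof.
move=> Br; rewrite canonical_cuts // => /consec_sub [i iS ->].
set c := cuts _ _ in iS *; rewrite /in_range /=.
have lt : (nth 0%N c i < nth 0%N c i.+1)%N.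
  by apply: (sorted_ltn_nth ltn_trans); rewrite ?inE ?(ltnW iS) ?cuts_sorted.
have : nth 0%N c i.+1 \in c by apply: mem_nth.
by rewrite mem_filter mem_iota /= => /andP [_]; lia.
Qed.

(** * Canonical intervals and the vectors v^k under t_i *)

(** The effect of t_i on cuts: no cut of t_i B meets the new singleton {i}, that is,
    none is at i - 1 or i. *)
Definition shift_cut (i c : nat) : nat := if (c + 2 <= i)%N then c else (c + 2)%N.

(** Away from i, the family t_i B covers what B covers at the collapsed position. *)
Lemma union_t_map (i x : nat) (B : {fset intv}) : (0 < i)%N -> x != i ->
    {in B, forall J, (J.1 <= J.2)%N} ->
  union_intv (t_map i B) x = union_intv B (if (x < i)%N then x else (x - 2)%N).
Proof.
move=> i0 xNi Bw.
have in_xi J : J \in B ->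
    in_intv x (xi i J) = in_intv (if (x < i)%N then x else (x - 2)%N) J.
  case: J => a b /Bw /= ab; rewrite /in_intv.
  by case: (xiP i a b) => * /=; case: (ltnP x i) => ?; lia.
apply/hasP/hasP => [[J /t_mapP [->|[I IB ->]]]|[J JB Jx]].
- by rewrite /in_intv /=; lia.
- by rewrite in_xi //; exists I.
- by exists (xi i J); rewrite ?t_map_xi ?in_xi.
Qed.

Lemma cuts_t_map (D i : nat) (B : {fset intv}) : (1 <= i <= D.+2)%N ->
    {in B, forall J, (J.1 <= J.2)%N} ->
  cuts (union_intv (t_map i B)) D.+3 =
  [seq shift_cut i c | c <- cuts (union_intv B) D.+1].
Proof.
move=> iD Bw; have [j [m [-> jm]]] : exists j m, i = j.+1 /\ D.+1 = (j + m)%N.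
  by exists i.-1, (D.+2 - i)%N; lia.
rewrite {iD}; set U := union_intv B; set U' := union_intv _.
have Uj : U' j.+1 = true.
  by apply/hasP; exists (j.+1, j.+1); rewrite ?t_map_self /in_intv /= ?leqnn.
have UE x : x != j.+1 -> U' x = U (if (x < j.+1)%N then x else (x - 2)%N).
  by move=> xj; apply: union_t_map.
have -> : D.+3 = (j + (2 + m))%N by lia.
rewrite /cuts jm.
rewrite iotaD filter_cat [iota _ (2 + m)]iotaD filter_cat /= add0n Uj /= andbF /=.
rewrite iotaD filter_cat map_cat; congr cat.
  rewrite map_id_in => [|x]; last first.
    by rewrite mem_filter mem_iota /shift_cut /= => /andP [_ xj]; rewrite ifT //; lia.
  apply: eq_in_filter => x; rewrite mem_iota /= => xj.
  by rewrite !UE ?ifT; try lia.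
rewrite add0n addnC iotaDl filter_map -[LHS]map_id.
have -> : [seq x <- iota j m | preim (addn 2) (fun x => ~~ U' x && ~~ U' x.+1) x] =
    [seq x <- iota j m | ~~ U x && ~~ U x.+1].
  apply: eq_in_filter => x; rewrite mem_iota => /andP [jx _] /=.
  rewrite !UE; try lia; rewrite !ifF; try lia.
  by rewrite addKn -addnS addKn.
rewrite map_id; apply/eq_in_map => x; rewrite mem_filter mem_iota => /and3P [_ jx _].
by rewrite /shift_cut ifF; lia.
Qed.

Lemma consec_eta (i : nat) (s : seq nat) : (0 < i)%N -> sorted ltn s ->
  consec [seq shift_cut i c | c <- s] = [seq xi i J | J <- consec s].
Proof.
move=> i0; case: s => // x s; elim: s x => // y s IH x /= /andP [xy ys].
congr cons; last exact: (IH y ys).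
rewrite /shift_cut; case: (xiP i x.+1 y) => *; case: ifP => ?; case: ifP => ?;
  congr pair; lia.
Qed.

Lemma canonical_t_map (D i : nat) (B : {fset intv}) : (1 <= i <= D.+2)%N ->
    {in B, forall J, in_range D J} ->
  canonical_intervals D.+2 (t_map i B) = [seq xi i J | J <- canonical_intervals D B].
Proof.
move=> iD Br; rewrite !canonical_cuts //; last first.
  move=> J /t_mapP [->|[I IB ->]]; first by rewrite /in_range /=; lia.
  by apply: xi_range => //; apply: Br.
rewrite cuts_t_map // ?consec_eta ?cuts_sorted //; first by case/andP: iD.
by move=> J /Br /andP [/andP []].
Qed.

Lemma cuts_fset0 (n : nat) : cuts (union_intv fset0) n = iota 0 n.
Proof.
have U0 x : union_intv fset0 x = false by apply/hasP => -[J]; rewrite inE.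
by rewrite /cuts -[RHS]filter_predT; apply: eq_filter => x; rewrite !U0.
Qed.

Lemma canonical_fset0 (D : nat) :
  canonical_intervals D fset0 = [seq (j, j) | j <- iota 1 D].
Proof.
by rewrite canonical_cuts => [|J]; rewrite ?cuts_fset0 ?consec_iota ?inE.
Qed.

(** Each insertion keeps the number of canonical intervals while D grows by 2 and
    the family by one interval. *)
Lemma size_canonical (D : nat) (B : {fset intv}) : B \in S_set D ->
  size (canonical_intervals D B) = (D - 2 * #|` B|)%N.
Proof.
move: D B; apply: S_set_ind => [D|D i B iD BS IH].
  by rewrite canonical_fset0 size_map size_iota cardfs0 subn0.
rewrite canonical_t_map ?size_map ?IH ?card_t_map //; first by lia.
exact: S_range BS.
Qed.

(** The formula for v^k with Delta and the list of canonical intervals as free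
    parameters, so that equal values of Delta can be substituted. *)
Definition coset_rep (D Delta k : nat) (s : seq intv) : 'V_D :=
  w_vec Delta k *m \matrix_(c < Delta) e_intv D (nth (0, 0)%N s c).

Lemma v_vecE (D k : nat) (B : {fset intv}) : B \in S_set D ->
  v_vec (E_of D B) k = coset_rep D (D - 2 * #|` B|) k (canonical_intervals D B).
Proof. by move=> BS; rewrite /v_vec /coset_rep B_of_E_of. Qed.

Lemma v_vec_t_map (D i k : nat) (B : {fset intv}) : (1 <= i <= D.+2)%N ->
    B \in S_set D ->
  v_vec (E_of D.+2 (t_map i B)) k = v_vec (E_of D B) k *m lift_mx D i.
Proof.
move=> iD BS; have Br := S_range BS.
rewrite !v_vecE ?S_set_t // canonical_t_map // card_t_map.
have -> : (D.+2 - 2 * #|` B|.+1 = D - 2 * #|` B|)%N by lia.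
rewrite /coset_rep -mulmxA; congr (_ *m _); apply/row_matrixP => c.
have cS : (c < size (canonical_intervals D B))%N by rewrite size_canonical.
rewrite row_mul !rowK (nth_map (0, 0)%N) // e_intv_xi //.
by apply: (canonical_range Br); apply: mem_nth.
Qed.

(** The canonical intervals of the empty family are the singletons of [1, D]. *)
Lemma v_vec_fset0 (D k : nat) : v_vec (E_of D fset0) k = w_vec D k.
Proof.
rewrite v_vecE ?S_set0 // cardfs0 subn0 /coset_rep canonical_fset0.
rewrite -[RHS]mulmx1; congr (_ *m _); apply/matrixP => c l.
rewrite mxE (nth_map 0%N) ?size_iota // nth_iota // e_intv1 add1n !mxE.
by rewrite eqSS eq_sym.
Qed.

(** * Walls and the function u-tilde *)

Definition wall (D : nat) (v : 'V_D) (x : nat) : bool :=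
  supp v x (+) supp v x.-1.

Definition wall_sum (D : nat) (v : 'V_D) : int :=
  \sum_(x <- iota 1 D.+1) (wall v x)%:R * (-1) ^+ x.

Lemma supp_0 (D : nat) (v : 'V_D) : supp v 0%N = false.
Proof. by rewrite supp_out. Qed.

Lemma supp_D1 (D : nat) (v : 'V_D) : supp v D.+1 = false.
Proof. by rewrite supp_out //; lia. Qed.

(** A run [a, b] has walls at a and b + 1; their signs agree when a and b have
    different parities and cancel otherwise. *)
Lemma u_fun_wall (D : nat) (v : 'V_D) : 2 * u_fun v = wall_sum v.
Proof.
have v0 := supp_0 v; have vD := supp_D1 v.
have -> : 2 * u_fun v = \sum_(J <- runs D (supp v)) ((-1) ^+ J.1 + (-1) ^+ J.2.+1).
  rewrite /u_fun big_mkcond mulr_sumr; apply: eq_bigr => J _.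
  rewrite -[in RHS]signr_odd exprS -[(-1) ^+ J.2]signr_odd -[in LHS]signr_odd.
  by case: (odd J.1); case: (odd J.2).
rewrite big_split /= -(big_map fst predT (fun x => (-1) ^+ x)).
rewrite -(big_map (fun J : intv => J.2.+1) predT (fun x => (-1) ^+ x)).
rewrite runs_starts // runs_stops // -starts_out // /starts /stops !big_filter.
rewrite big_mkcond [X in _ + X]big_mkcond -big_split; apply: eq_bigr => x _ /=.
rewrite /wall; case: (supp v x); case: (supp v x.-1) => /=.
all: by rewrite ?addr0 ?add0r ?mul1r ?mul0r.
Qed.

Lemma u_tilde_wall (D : nat) (v w : 'V_D) :
  (u_tilde v == u_tilde w) = (wall_sum v == wall_sum w).
Proof.
rewrite -!u_fun_wall /u_tilde; apply/eqP/eqP.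
  by case: ifP => ?; case: ifP => ?; lia.
by move=> E; have -> : u_fun v = u_fun w by lia.
Qed.

Lemma big_iota_split (F : nat -> int) (j m : nat) :
  \sum_(x <- iota 1 (j + (2 + m))) F x =
  \sum_(x <- iota 1 j) F x + (F j.+1 + (F j.+2 + \sum_(x <- iota j.+3 m) F x)).
Proof. by rewrite iotaD big_cat [iota _ (2 + m)]iotaD /= addn2 !add1n !big_cons. Qed.

(** The walls at i and i + 1 are both present or both absent before the flip, and
    they have opposite signs. *)
Lemma wall_sum_flip (D i : nat) (v : 'V_D) : (1 <= i <= D)%N ->
  supp v i.-1 = supp v i.+1 -> wall_sum (v + e_vec D i) = wall_sum v.
Proof.
case: i => // j jD /= vj.
have [m Dm] : exists m, D.+1 = (j + (2 + m))%N by exists (D - j.+1)%N; lia.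
have off x : x != j.+1 -> supp (v + e_vec D j.+1) x = supp v x.
  by move=> xj; rewrite suppD supp_e_vec (negbTE xj) andbF addbF.
have at_i : supp (v + e_vec D j.+1) j.+1 = ~~ supp v j.+1.
  by rewrite suppD supp_e_vec jD eqxx addbT.
rewrite /wall_sum Dm !big_iota_split.
have eqF s : (forall x, x \in s -> (x <= j)%N || (j.+3 <= x)%N) ->
    \sum_(x <- s) (wall (v + e_vec D j.+1) x)%:R * (-1) ^+ x
  = \sum_(x <- s) (wall v x)%:R * (-1) ^+ x :> int.
  move=> sP; apply: eq_big_seq => x /sP xj.
  by rewrite /wall !off //; lia.
rewrite !eqF; try by move=> x; rewrite mem_iota; lia.
congr (_ + _); rewrite !addrA; congr (_ + _).
rewrite /wall /= at_i !off //; try lia; rewrite -vj !exprS.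
by case: (supp v j.+1); case: (supp v j) => /=; ring.
Qed.

(** T_i puts no wall at i and i + 1 and shifts the later walls by 2, which preserves
    their signs. *)
Lemma wall_sum_lift (D i : nat) (v : 'V_D) : (1 <= i <= D.+2)%N ->
  wall_sum (v *m lift_mx D i) = wall_sum v.
Proof.
case: i => // j jD.
have [m Dm] : exists m, D.+1 = (j + m)%N by exists (D.+1 - j)%N; lia.
have D3 : D.+3 = (j + (2 + m))%N by lia.
rewrite /wall_sum D3 big_iota_split [iota 1 D.+1](congr1 (iota 1) Dm) iotaD big_cat /=.
have E x : (x <= D.+3)%N -> supp (v *m lift_mx D j.+1) x = supp v (collapse j.+1 x).
  move=> xD; rewrite supp_lift; case: (boolP (1 <= x <= D.+2)%N) => //= xD'.
  rewrite supp_out // /collapse; case: (ltngtP x j.+1) => ? /=; lia.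
have -> : wall (v *m lift_mx D j.+1) j.+1 = false.
  by rewrite /wall !E ?/collapse ?ltnn ?eqxx ?ltnSn ?addbb //=; lia.
have -> : wall (v *m lift_mx D j.+1) j.+2 = false.
  rewrite /wall !E ?/collapse ?ltnn ?eqxx /=; try lia.
  by rewrite ifF ?ifF ?subSS ?subn0 ?addbb //; lia.
rewrite !mul0r !add0r; congr (_ + _).
  apply: eq_big_seq => x; rewrite mem_iota => xj.
  by rewrite /wall !E /collapse ?ifT //; lia.
rewrite -[j.+3]/(2 + j.+1)%N iotaDl big_map add1n; apply: eq_big_seq => x.
rewrite mem_iota => xj; rewrite exprD sqrrN expr1n mul1r /wall !E; try lia.
have -> : collapse j.+1 (2 + x) = x by rewrite /collapse ifF ?ifF; lia.
suff -> : collapse j.+1 (2 + x).-1 = x.-1 by [].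
by rewrite /collapse; case: (ltngtP (2 + x).-1 j.+1) => /=; lia.
Qed.

(** * The level of w_k *)

Definition triangular (n : nat) : nat := ((n * n.+1) %/ 2)%N.

Lemma triangularS (n : nat) : triangular n.+1 = (triangular n + n.+1)%N.
Proof.
by rewrite /triangular -divnDMl //; congr (_ %/ 2)%N; lia.
Qed.

(** The number of intervals of P_k that contain x. *)
Definition depth (D k x : nat) : nat := minn k (minn x (D.+1 - x)).

Lemma n_bar_Some (D k : nat) (c : 'I_D) : (k <= D./2)%N ->
  n_bar k (Some c) = (k - depth D k c.+1)%N.
Proof.
rewrite /n_bar /P_list count_map /depth; have xD := ltn_ord c.
elim: k => [|k IH] kD //; rewrite -[k.+1]addn1 iotaD count_cat IH /=; last by lia.
by rewrite /in_intv_bar /in_intv /=; lia.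
Qed.

Lemma n_bar_None (D k : nat) : @n_bar D k None = k.
Proof. by rewrite /n_bar count_predT size_map size_iota. Qed.

(** The coefficient of e_x in w_k is the sum of the term of x and the term of the
    extra symbol, for which n = k.  The formula also holds at 0 and D + 1. *)
Lemma supp_w_vec (D k x : nat) : (k <= D./2)%N -> (x <= D.+1)%N ->
  supp (w_vec D k) x = odd (triangular (k - depth D k x)) (+) odd (triangular k).
Proof.
move=> kD xD; case: (boolP (1 <= x <= D)%N) => [|xout]; last first.
  by rewrite supp_out // (_ : depth D k x = 0%N) ?subn0 ?addbb // /depth; lia.
case: x {xD} => // x xD; rewrite (supp_ord _ (Ordinal xD)) /w_vec summxE.
rewrite (bigD1 None) // (bigD1 (Some (Ordinal xD))) //=.
rewrite [X in _ + (_ + X)]big1 ?addr0; last first.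
  case=> [c|]; rewrite ?eqxx //= => cx; rewrite !mxE eqSS.
  case: eqP => [xc|_]; last by rewrite mulr0.
  by case/eqP: cx; congr Some; apply/val_inj.
have odd_F2 n : ((n%:R : 'F_2) != 0) = odd n.
  rewrite -[RHS]F2_natr_neq0 -[in LHS](odd_double_half n) natrD -muln2 natrM.
  rewrite (_ : 2%:R = 0) ?mulr0 ?addr0 //.
  exact/val_inj.
have aE : (\sum_(c < D) e_vec D c.+1) 0 (Ordinal xD) = 1.
  rewrite summxE (bigD1 (Ordinal xD)) //= mxE eqxx big1 ?addr0 // => c cx.
  by rewrite mxE eqSS; case: eqP => // xc; case/eqP: cx; apply/val_inj.
rewrite !mxE eqxx aE !mulr1 n_bar_None n_bar_Some // F2_add_neq0 addbC.
by rewrite !odd_F2.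
Qed.

(** The triangular numbers of n and n + 1 differ in parity exactly when n + 1 is odd;
    the depth changes by one at each of the first k and last k places and is
    constant in between. *)
Lemma wall_w_vec (D k x : nat) : (k <= D./2)%N -> (1 <= x <= D.+1)%N ->
  wall (w_vec D k) x =
  (if (x <= k)%N then odd (k - x).+1
   else if (x + k <= D.+1)%N then false else odd (k - (D.+2 - x)).+1).
Proof.
move=> kD xD; rewrite /wall !supp_w_vec //; try lia.
rewrite addbACA addbb addbF /depth.
have oddT n : odd (triangular n) (+) odd (triangular n.+1) = odd n.+1.
  by rewrite triangularS oddD addbA addbb.
case: ifP => xk; [|case: ifP => xk'].
- have -> : (k - minn k (minn x (D.+1 - x)) = k - x)%N by lia.
  have -> : (k - minn k (minn x.-1 (D.+1 - x.-1)) = (k - x).+1)%N by lia.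
  exact: oddT.
- have -> : (minn k (minn x (D.+1 - x)) = k)%N by lia.
  have -> : (minn k (minn x.-1 (D.+1 - x.-1)) = k)%N by lia.
  exact: addbb.
have -> : (k - minn k (minn x (D.+1 - x)) = (k - (D.+2 - x)).+1)%N by lia.
have -> : (k - minn k (minn x.-1 (D.+1 - x.-1)) = k - (D.+2 - x))%N by lia.
by rewrite addbC; apply: oddT.
Qed.

Lemma sum_odd_rev (k : nat) :
  \sum_(x <- iota 1 k) (odd (k - x).+1)%:R = (uphalf k)%:R :> int.
Proof.
elim: k => [|k IH]; first by rewrite big_nil.
rewrite /= big_cons -[2%N]/(1 + 1)%N iotaDl big_map subn1 /=.
have -> : \sum_(j <- iota 1 k) (odd (k.+1 - (1 + j)).+1)%:R = (uphalf k)%:R :> int.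
  by rewrite -IH; apply: eq_bigr => j _; rewrite add1n subSS.
by rewrite -natrD; congr (_%:R); lia.
Qed.

Lemma sum_odd (k : nat) :
  \sum_(x <- iota 0 k) (odd x.+1)%:R = (uphalf k)%:R :> int.
Proof.
elim: k => [|k IH]; first by rewrite big_nil.
by rewrite -addn1 iotaD big_cat IH /= big_cons big_nil addr0 -natrD; congr (_%:R); lia.
Qed.

(** The walls are at the x <= k with the parity of k and, D being even, at their mirror
    images D + 2 - x, which have the same parity.  All of them have sign (-1)^k, and
    there are twice the upper half of k of them. *)
Lemma wall_sum_w_vec (D k : nat) : ~~ odd D -> (k <= D./2)%N ->
  wall_sum (w_vec D k) = 2 * ((-1) ^+ k * (uphalf k)%:R).
Proof.
move=> Deven kD; rewrite /wall_sum.
have kD2 : (k + k <= D)%N by lia.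
have -> : iota 1 D.+1 = iota 1 k ++ iota k.+1 (D.+1 - (k + k)) ++ iota (D.+2 - k) k.
  rewrite -[k.+1]add1n (_ : D.+2 - k = 1 + (k + (D.+1 - (k + k))))%N; last by lia.
  by rewrite catA -iotaD -iotaD; congr iota; lia.
have signE x : odd (k - x).+1 -> (x <= k)%N -> (-1) ^+ x = (-1) ^+ k :> int.
  move=> kx xk; rewrite -signr_odd -[RHS]signr_odd.
  by congr (_ ^+ (nat_of_bool _)); lia.
rewrite !big_cat /=.
have -> : \sum_(x <- iota 1 k) (wall (w_vec D k) x)%:R * (-1) ^+ x =
    (-1) ^+ k * (uphalf k)%:R :> int.
  rewrite -sum_odd_rev mulr_sumr; apply: eq_big_seq => x; rewrite mem_iota => xI.
  rewrite wall_w_vec ?ifT; try lia.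
  case kx : (odd (k - x).+1); last by rewrite mulr0 mul0r.
  by rewrite (signE x) ?mulr1 ?mul1r //; lia.
have -> : \sum_(x <- iota k.+1 (D.+1 - (k + k)))
    (wall (w_vec D k) x)%:R * (-1) ^+ x = 0 :> int.
  rewrite big_seq big1 // => x; rewrite mem_iota => xI.
  by rewrite wall_w_vec ?(ifF _ _ (_ : (x <= k)%N = false)) ?ifT ?mul0r //; lia.
have -> : \sum_(x <- iota (D.+2 - k) k) (wall (w_vec D k) x)%:R * (-1) ^+ x =
    (-1) ^+ k * (uphalf k)%:R :> int.
  rewrite -[(D.+2 - k)%N]addn0 iotaDl big_map -sum_odd mulr_sumr.
  apply: eq_big_seq => x; rewrite mem_iota => xI.
  rewrite wall_w_vec ?ifF; try lia.
  have -> : (k - (D.+2 - (D.+2 - k + x)) = x)%N by lia.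
  rewrite mulrC; case ox : (odd x.+1); rewrite ?mulr0 // !mulr1.
  by rewrite -signr_odd -[RHS]signr_odd; congr (_ ^+ (nat_of_bool _)); lia.
by rewrite add0r mulr_natl mulr2n.
Qed.

Lemma u_tilde_w_vec (D k : nat) : ~~ odd D -> (k <= D./2)%N ->
  u_tilde (w_vec D k) = k.
Proof.
move=> Deven kD; have := u_fun_wall (w_vec D k); rewrite wall_sum_w_vec //.
move/(mulfI (isT : (2 : int) != 0)); rewrite /u_tilde => ->.
rewrite -signr_odd; case ok : (odd k) => /=; rewrite ?expr1 ?expr0 ?mulN1r ?mul1r.
  by case: ifP => ?; lia.
by rewrite ler0n; lia.
Qed.

(** * Connectedness of the levels *)

Lemma sum_bool_count (P : pred nat) (s : seq nat) :
  \sum_(x <- s) (P x)%:R = (count P s)%:R :> int.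
Proof.
by elim: s => [|x s IH]; rewrite ?big_nil // big_cons IH -natrD.
Qed.

(** Exchanging walls and non-walls at odd places turns the signed wall count into a
    plain count of letters (up to a constant), and the creation of two adjacent walls
    into a transposition of two different adjacent letters. *)
Definition wall_word (D : nat) (v : 'V_D) : seq bool :=
  [seq wall v x (+) odd x | x <- iota 1 D.+1].

Lemma wall_sum_count (D : nat) (v : 'V_D) :
  wall_sum v = (count id (wall_word v))%:R - (uphalf D.+1)%:R.
Proof.
apply/eqP; rewrite eq_sym subr_eq /wall_sum /wall_word count_map -sum_bool_count.
have <- : \sum_(x <- iota 1 D.+1) (odd x)%:R = (uphalf D.+1)%:R :> int.
  rewrite -sum_odd -[1%N]addn0 iotaDl big_map.
  by apply: eq_bigr.
rewrite -big_split; apply/eqP; apply: eq_bigr => x _ /=.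
by rewrite -signr_odd; case: (wall v x); case: (odd x).
Qed.

(** The wall word has between 0 and D + 1 letters true. *)
Lemma u_tilde_le (D : nat) (v : 'V_D) : ~~ odd D -> (u_tilde v <= D./2)%N.
Proof.
move=> Deven; have := u_fun_wall v; rewrite wall_sum_count.
have : (count id (wall_word v) <= D.+1)%N.
  by rewrite (leq_trans (count_size _ _)) // size_map size_iota.
rewrite /u_tilde; move: (count _ _) => n nD uE.
by case: ifP => u0; lia.
Qed.

(** Transpositions of adjacent letters generate all rearrangements. *)
Lemma perm_swap_ind (T : eqType) (Q : seq T -> Prop) :
    (forall p a b q, Q (p ++ a :: b :: q) -> Q (p ++ b :: a :: q)) ->
  forall s t, perm_eq s t -> Q s -> Q t.
Proof.
move=> Qswap.
(* A letter moves to the right across q, one transposition at a time. *)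
have back p q x r : Q (p ++ x :: q ++ r) -> Q (p ++ q ++ x :: r).
  elim: q p => [//|y q IH] p Qs; rewrite cat_cons -(cat_rcons y p).
  by apply: IH; rewrite cat_rcons; apply: Qswap.
move=> s t st; rewrite -[s]cat0s -[t]cat0s; move: [::] => p.
elim: s p t st => [|x s IH] p t; first by rewrite perm_sym => /perm_nilP->.
move=> st; have xt : x \in t by rewrite -(perm_mem st) mem_head.
case/splitPr: xt st => t1 t2.
rewrite perm_sym -cat1s perm_catCA /= perm_cons perm_sym => st Qs.
by apply: back; rewrite -cat_rcons; apply: IH => //; rewrite cat_rcons.
Qed.

(** The inverse of [wall_word]: letter x is the parity of the number of walls up to x. *)
Definition word_vec (D : nat) (s : seq bool) : 'V_D :=
  vec_of D (fun x => odd (count id (take x s)) (+) odd (uphalf x)).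

Lemma wall_wordK (D : nat) (v : 'V_D) (x : nat) : (x <= D.+1)%N ->
  odd (count id (take x (wall_word v))) (+) odd (uphalf x) = supp v x.
Proof.
rewrite /wall_word; elim: x => [|x IH] xD; first by rewrite take0 supp_0.
rewrite (take_nth false) ?size_map ?size_iota // -cats1 count_cat oddD.
rewrite (nth_map 0%N) ?size_iota // nth_iota // add1n [count id [:: _]]/=.
have -> : odd (uphalf x.+1) = odd (uphalf x) (+) odd x.+1 by lia.
rewrite addn0 oddb addbACA IH; last exact: ltnW.
by rewrite /wall /=; case: (supp v x); case: (supp v x.+1); case: (odd x).
Qed.

Lemma word_vecK (D : nat) (v : 'V_D) : word_vec D (wall_word v) = v.
Proof.
apply: supp_inj => x; rewrite supp_vec_of.
case: (boolP (1 <= x <= D)%N) => [xD|/supp_out-> //].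
by rewrite wall_wordK //; lia.
Qed.

Lemma supp_word_vec (D : nat) (s : seq bool) (x : nat) :
    size s = D.+1 -> odd (count id s) = odd (uphalf D.+1) -> (x <= D.+1)%N ->
  supp (word_vec D s) x = odd (count id (take x s)) (+) odd (uphalf x).
Proof.
move=> sD sodd xD; rewrite supp_vec_of.
case: (posnP x) => [->|x0]; first by rewrite take0.
case: (leqP x D) => [//|Dx]; have -> : x = D.+1 by lia.
by rewrite take_oversize ?sD // sodd addbb.
Qed.

(** Two vectors of the same level have wall words with equally many letters true,
    hence rearrangements of each other, and a transposition of two different adjacent
    letters at positions i and i + 1 is the flip at i. *)
Lemma flip_connected (D : nat) (Q : 'V_D -> Prop) :
    (forall v i, (1 <= i <= D)%N -> supp v i.-1 = supp v i.+1 ->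
       Q v -> Q (v + e_vec D i)) ->
  forall v w, u_tilde v = u_tilde w -> Q v -> Q w.
Proof.
move=> Qflip v w vw Qv.
(* The parity condition says that word_vec s closes up to the letter 0 at D + 1. *)
pose Qs (s : seq bool) := [/\ size s = D.+1, odd (count id s) = odd (uphalf D.+1)
                & Q (word_vec D s)].
have sizeW (u : 'V_D) : size (wall_word u) = D.+1 by rewrite size_map size_iota.
have cnt : count id (wall_word v) = count id (wall_word w).
  by move/eqP: vw; rewrite u_tilde_wall !wall_sum_count => /eqP; lia.
have pm : perm_eq (wall_word v) (wall_word w).
  apply/permP => a.
  have ca s : count a s = (a true * count id s + a false * (size s - count id s))%N.
    elim: s => [|b s IH] /=; first by rewrite !muln0.
    have := count_size id s; rewrite IH.
    by case: b => /=; case: (a true); case: (a false) => /=; lia.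
  by rewrite !ca !sizeW cnt.
have swap (p q : seq bool) (a b : bool) :
    Qs (p ++ a :: b :: q) -> Qs (p ++ b :: a :: q).
  have [<- //|ab] := eqVneq a b; move=> [sz od Qp].
  have sz' : size (p ++ b :: a :: q) = D.+1 by rewrite -sz !size_cat.
  have od' : odd (count id (p ++ b :: a :: q)) = odd (uphalf D.+1).
    by rewrite -od !count_cat /= (addnCA (nat_of_bool b)).
  split=> //; set i := (size p).+1.
  have iD : (1 <= i <= D)%N by move: sz; rewrite size_cat /= /i; lia.
  suff -> : word_vec D (p ++ b :: a :: q) = word_vec D (p ++ a :: b :: q) + e_vec D i.
    apply: Qflip => //; rewrite !supp_word_vec //; try lia.
    rewrite !take_cat /i /= ltnn subnn take0 cats0 ifF; last by lia.
    rewrite (_ : (size p).+2 - size p = 2)%N /=; last by lia.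
    rewrite take0 count_cat /=.
    by move: ab; case: a {Qp od sz sz' od'}; case: b => //= _; lia.
  apply: supp_inj => x; rewrite suppD supp_e_vec.
  case: (boolP (1 <= x <= D)%N) => [xD|xD] /=; last by rewrite !supp_out.
  rewrite !supp_word_vec //; try lia.
  rewrite addbAC; congr addb; rewrite !take_cat.
  case: (ltngtP x (size p)) => [xp|xp|->]; first by rewrite addbC; case: eqP => //; lia.
    case E : (x - size p)%N => [|[|y]] /=; first by lia.
      rewrite ?take0 !count_cat /= (_ : x == i); last by rewrite /i; lia.
      by move: ab; case: a {Qp od sz sz' od'}; case: b => //= _; lia.
    rewrite (_ : (x == i) = false) ?addbF; last by rewrite /i; lia.
    by rewrite !count_cat /= (addnCA (nat_of_bool b)).
  by rewrite subnn /= /i (_ : (size p == (size p).+1) = false) ?addbF //; lia.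
suff : Qs (wall_word w) by case=> _ _; rewrite word_vecK.
apply: (perm_swap_ind (Q := Qs) _ pm) => [p a b q|]; first exact: swap.
split; rewrite ?word_vecK //.
have := wall_wordK v (leqnn D.+1); rewrite supp_D1.
rewrite take_oversize ?sizeW //.
by case: (odd (count _ _)); case: (odd (uphalf _)).
Qed.

(** * Counting the pairs (E, k) *)

(** The families t_(i_1) t_(i_2) ... of S_D, D = 2 n, with i_1 >= a and
    i_(r+1) >= i_r - 1. *)
Fixpoint normal_forms (n a : nat) : seq {fset intv} :=
  fset0 :: if n is n'.+1 then
             [seq t_map i B | i <- index_iota (maxn 1 a) n.*2.+1,
                              B <- normal_forms n' i.-1]
           else [::].

Lemma mem_normal_forms (n a : nat) (B : {fset intv}) :
  B \in normal_forms n.+1 a <->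
  B = fset0 \/ exists i C, [/\ (maxn 1 a <= i <= n.+1.*2)%N,
                              C \in normal_forms n i.-1 & B = t_map i C].
Proof.
rewrite [normal_forms _ _]/= in_cons; split.
  case/predU1P => [->|/allpairsPdep [i [C [iI CN ->]]]]; first by left.
  by right; exists i, C; split=> //; move: iI; rewrite mem_index_iota ltnS.
case=> [->|[i [C [iI CN ->]]]]; first by rewrite eqxx.
apply/orP; right; apply/allpairsPdep; exists i, C; split=> //.
by rewrite mem_index_iota ltnS.
Qed.

Lemma normal_forms0 (n a : nat) : fset0 \in normal_forms n a.
Proof. by case: n => [|n]; rewrite mem_head. Qed.

(** If i <= j + 1 then t_i t_j ... is already in normal form; otherwise it equals
    t_j t_(i-2) ..., and the induction applies to the tail. *)
Lemma normal_forms_t (n i b : nat) (B : {fset intv}) :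
    B \in normal_forms n b -> (1 <= i <= n.+1.*2)%N ->
  t_map i B \in normal_forms n.+1 (minn i b).
Proof.
elim: n i b B => [|n IH] i b B.
  move=> /= + iD; rewrite inE => /eqP->; apply/mem_normal_forms; right.
  by exists i, fset0; split=> //; lia.
case/mem_normal_forms => [->|[j [C [jD CN ->]]]] iD.
  apply/mem_normal_forms; right; exists i, fset0; split; rewrite ?normal_forms0 //.
  lia.
apply/mem_normal_forms; right; case: (leqP i j.+1) => ij.
  exists i, (t_map j C); split=> //; first by lia.
  by apply/mem_normal_forms; right; exists j, C; split=> //; lia.
exists j, (t_map (i - 2) C); split; first by lia.
  have -> : j.-1 = minn (i - 2) j.-1 by lia.
  by apply: IH => //; lia.
by apply: t_map_comm; lia.
Qed.

Lemma S_set_normal_forms (n : nat) (B : {fset intv}) :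
  B \in S_set n.*2 -> B \in normal_forms n 0.
Proof.
elim: n B => [|n IH] B; first by rewrite inE => /eqP->; apply: normal_forms0.
case/S_setP => [->|[i [C [iD CS ->]]]]; first exact: normal_forms0.
by rewrite -(minn0 i); apply: normal_forms_t => //; apply: IH.
Qed.

(** The number of pairs (B, k) with B a normal form and k <= n - |B|. *)
Definition pair_count (n a : nat) : nat :=
  \sum_(B <- normal_forms n a) (n - #|` B|).+1.

Lemma pair_count0 (a : nat) : pair_count 0 a = 1%N.
Proof. by rewrite /pair_count big_cons big_nil. Qed.

Lemma pair_countS (n a : nat) :
  pair_count n.+1 a =
  (n.+2 + \sum_(maxn 1 a <= i < n.+1.*2.+1) pair_count n i.-1)%N.
Proof.
rewrite /pair_count [normal_forms _ _]/= big_cons cardfs0 subn0; congr addn.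
rewrite big_allpairs_dep; apply: eq_bigr => i _.
by apply: eq_bigr => B _; rewrite card_t_map subSS.
Qed.

(** The iterated partial sums of the N-th row of the Pascal triangle. *)
Definition bin_sum2 (N s : nat) : nat := \sum_(m < s) (s - m) * 'C(N, m).

Lemma bin_sum2_0 (N : nat) : bin_sum2 N 0 = 0%N.
Proof. by rewrite /bin_sum2 big_ord0. Qed.

Lemma bin_sum2_0n (s : nat) : bin_sum2 0 s = s.
Proof.
case: s => [|s]; first exact: bin_sum2_0.
rewrite /bin_sum2 big_ord_recl big1 ?addn0 /= ?muln1 ?subn0 // => i _.
by rewrite bin0n muln0.
Qed.

(** The Pascal rule is inherited by iterated partial sums. *)
Lemma bin_sum2S (N s : nat) :
  bin_sum2 N.+1 s.+1 = (bin_sum2 N s.+1 + bin_sum2 N s)%N.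
Proof.
rewrite /bin_sum2 big_ord_recl [in RHS]big_ord_recl /= !bin0 -addnA; congr addn.
rewrite -big_split; apply: eq_bigr => i _ /=.
by rewrite /bump /= add1n binS mulnDr subSS.
Qed.

Lemma bin_sum2_diff (N s : nat) :
  bin_sum2 N s.+1 = (bin_sum2 N s + \sum_(m < s.+1) 'C(N, m))%N.
Proof.
rewrite /bin_sum2 !big_ord_recr /= addnA subSnn mul1n; congr addn.
rewrite -big_split; apply: eq_bigr => i _ /=.
by rewrite subSn ?mulSn 1?addnC // ltnW.
Qed.

(** A reflection formula of ballot type.  Both sides satisfy the recurrence
    in a obtained by separating the words with i_1 = a, whose tails are counted by
    n - 1 and a - 1; at a = 0 the recurrence is replaced by the equality of the counts
    for a = 0 and a = 1. *)
Lemma pair_count_closed (n a : nat) : (a <= n.*2.+1)%N ->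
  (pair_count n a + bin_sum2 (n.*2.+1 - a) (n - a))%N = bin_sum2 (n.*2.+1 - a) n.+1.
Proof.
elim: n a => [|n IH] a aD.
  rewrite pair_count0 sub0n bin_sum2_0.
  by case: a aD => [|[|a]] // _; rewrite ?bin_sum2S ?bin_sum2_0n.
(* The values a >= 1, by decreasing a: N stands for n.+1.*2.+1 - a. *)
have pos N : (N <= n.+1.*2)%N ->
    (pair_count n.+1 (n.+1.*2.+1 - N) + bin_sum2 N (n.+1 - (n.+1.*2.+1 - N)))%N
    = bin_sum2 N n.+2.
  elim: N => [|N IHN] ND.
    rewrite pair_countS !bin_sum2_0n subn0 big_geq ?addn0; last by lia.
    by rewrite (_ : n.+1 - n.+1.*2.+1 = 0)%N; lia.
  have IHN' := IHN (ltnW ND).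
  set b := (n.+1.*2.+1 - N.+1)%N.
  have bE : (n.+1.*2.+1 - N = b.+1)%N by rewrite /b; lia.
  have step : pair_count n.+1 b = (pair_count n.+1 b.+1 + pair_count n b.-1)%N.
    rewrite !pair_countS big_ltn; last by rewrite /b; lia.
    rewrite (_ : maxn 1 b = b); last by rewrite /b; lia.
    rewrite (_ : maxn 1 b.+1 = b.+1); last by lia.
    by rewrite addnCA addnC.
  have := IH b.-1; rewrite (_ : n.*2.+1 - b.-1 = N)%N; last by rewrite /b; lia.
  rewrite (_ : n - b.-1 = n.+1 - b)%N; last by rewrite /b; lia.
  move=> /(_ _) IHb; rewrite step bin_sum2S -IHN' bE -IHb; last by rewrite /b; lia.
  (* The truncated n.+1 - b is 0 when b > n; both correction terms vanish then. *)
  case E : (n.+1 - b)%N => [|m].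
    by rewrite !bin_sum2_0 (_ : n.+1 - b.+1 = 0)%N ?bin_sum2_0; lia.
  by rewrite bin_sum2S (_ : n.+1 - b.+1 = m)%N; lia.
case: a aD => [_|a aD]; last first.
  have := pos (n.+1.*2.+1 - a.+1)%N; rewrite subKn //; apply; lia.
have := pos n.+1.*2 (leqnn _); rewrite subSnn subn1 succnK => p1.
have -> : pair_count n.+1 0 = pair_count n.+1 1 by rewrite !pair_countS.
rewrite !subn0 (bin_sum2S n.+1.*2 n) (bin_sum2S n.+1.*2 n.+1) -p1; lia.
Qed.

(** Half of an odd row of the Pascal triangle. *)
Lemma half_binomial_sum (n : nat) : \sum_(m < n.+1) 'C(n.*2.+1, m) = (2 ^ n.*2)%N.
Proof.
apply/eqP; rewrite -(eqn_pmul2l (ltn0Sn 1)) -expnS; apply/eqP.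
have <- : \sum_(m < n.+1 + n.+1) 'C(n.*2.+1, m) = (2 ^ n.*2.+1)%N.
  rewrite -[2%N]/(1 + 1)%N expnDn (_ : n.+1 + n.+1 = n.*2.+2)%N; last by lia.
  by apply: eq_bigr => i _; rewrite !exp1n !muln1.
rewrite big_split_ord /= mul2n -addnn; congr addn.
rewrite (reindex_inj rev_ord_inj) /=; apply: eq_bigr => i _.
rewrite -bin_sub; last by have := ltn_ord i; lia.
by congr ('C(_, _)); have := ltn_ord i; lia.
Qed.

(** At a = 0 the closed form is a difference of consecutive iterated sums, that is, a
    partial sum of row 2 n + 1. *)
Lemma pair_count_total (n : nat) : pair_count n 0 = (2 ^ n.*2)%N.
Proof.
have := pair_count_closed (leq0n n.*2.+1).
rewrite !subn0 bin_sum2_diff half_binomial_sum addnC => /eqP.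
by rewrite eqn_add2l => /eqP.
Qed.

(** * Cosets E + v^k under t_i *)

Lemma mem_E_lift (D i : nat) (B : {fset intv}) (x : 'V_D) : (1 <= i <= D.+2)%N ->
    {in B, forall J, in_range D J} ->
  (x *m lift_mx D i \in E_of D.+2 (t_map i B)) = (x \in E_of D B).
Proof.
move=> iD Br; apply/idP/idP => [/mem_E_t_map [] // y yE xy|xE].
  by rewrite -(lift_mxK x iD); case: xy => ->; rewrite ?lift_mxK ?lift_mxKe.
by apply/mem_E_t_map => //; exists x; [|left].
Qed.

Lemma mem_E_lift_e (D i : nat) (B : {fset intv}) (x : 'V_D) : (1 <= i <= D.+2)%N ->
    {in B, forall J, in_range D J} ->
  (x *m lift_mx D i + e_vec D.+2 i \in E_of D.+2 (t_map i B)) = (x \in E_of D B).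
Proof.
move=> iD Br; rewrite rpredDr ?mem_E_lift //.
apply/mem_E_t_map => //; exists 0; first exact: mem0v.
by right; rewrite mul0mx add0r.
Qed.

Lemma coset_t_map (D i k : nat) (B : {fset intv}) (v : 'V_D.+2) :
    (1 <= i <= D.+2)%N -> B \in S_set D ->
    v - v_vec (E_of D.+2 (t_map i B)) k \in E_of D.+2 (t_map i B) ->
  exists2 x, x - v_vec (E_of D B) k \in E_of D B &
    v = x *m lift_mx D i \/ v = x *m lift_mx D i + e_vec D.+2 i.
Proof.
move=> iD BS; have Br := S_range BS.
rewrite v_vec_t_map // => /mem_E_t_map [] // y yE vy.
exists (y + v_vec (E_of D B) k); first by rewrite addrK.
rewrite mulmxDl; case: vy => /(canRL (subrK _)) ->; [by left|right].
by rewrite addrAC.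
Qed.

Lemma wall_sum_t (D i : nat) (v : 'V_D) : (1 <= i <= D.+2)%N ->
  wall_sum (v *m lift_mx D i + e_vec D.+2 i) = wall_sum v.
Proof. by move=> iD; rewrite wall_sum_flip ?wall_sum_lift ?lift_flat. Qed.

Lemma u_tilde_eq (D D' : nat) (v : 'V_D) (w : 'V_D') :
  wall_sum v = wall_sum w -> u_tilde v = u_tilde w.
Proof.
rewrite -!u_fun_wall => /(mulfI (isT : (2 : int) != 0)).
by rewrite /u_tilde => ->.
Qed.

(** Peeling off the insertions that build B reduces the claim to w_k, without changing
    u-tilde. *)
Lemma coset_u_tilde (D k : nat) (B : {fset intv}) (v : 'V_D) : ~~ odd D ->
    B \in S_set D -> (k <= D./2 - #|` B|)%N ->
  v - v_vec (E_of D B) k \in E_of D B -> u_tilde v = k.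
Proof.
move=> Deven BS; move: D B BS Deven v; apply: S_set_ind => [D|D i B iD BS IH] Deven v.
  rewrite cardfs0 subn0 v_vec_fset0 /E_of span_nil memv0 subr_eq0 => kD /eqP->.
  exact: u_tilde_w_vec.
rewrite card_t_map => kD /coset_t_map [] // x xE vx.
have -> : u_tilde v = u_tilde x.
  apply: u_tilde_eq; case: vx => ->; first exact: wall_sum_lift.
  exact: wall_sum_t.
by apply: IH => //; lia.
Qed.

(** * The elements f^k_E span *)

Section Spanning.

Variable R : realType.

Lemma f_eltE (D k : nat) (E : {vspace 'V_D}) (y : 'V_D) :
  f_elt R E k y = (y - v_vec E k \in E)%:R.
Proof.
rewrite /f_elt sum_ffunE; have [yE|yE] := boolP (y - v_vec E k \in E).
  rewrite (bigD1 y) //= big1 ?ffunE ?eqxx ?addr0 // => v /andP [_ vy].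
  by rewrite ffunE eq_sym (negbTE vy).
rewrite big1 // => v vE; rewrite ffunE; case: eqP => // yv.
by move: yE; rewrite yv vE.
Qed.

(** The linear extension of [x] |-> [T_i x] + [T_i x + e_i]. *)
Definition induce (D i : nat) (g : CV R D) : CV R D.+2 :=
  \sum_(x : 'V_D) (g x : R[i]%C) *:
    (formal R (x *m lift_mx D i) + formal R (x *m lift_mx D i + e_vec D.+2 i)).

Fact induce_linear (D i : nat) : linear (@induce D i).
Proof.
move=> a g h; rewrite /induce scaler_sumr -big_split; apply: eq_bigr => x _ /=.
by rewrite scalerA -scalerDl !ffunE.
Qed.

HB.instance Definition _ (D i : nat) :=
  GRing.isLinear.Build R[i]%C (CV R D) (CV R D.+2) *:%R (@induce D i)
    (@induce_linear D i).

Lemma induce_formal (D i : nat) (x : 'V_D) :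
  induce i (formal R x) =
  formal R (x *m lift_mx D i) + formal R (x *m lift_mx D i + e_vec D.+2 i).
Proof.
rewrite /induce (bigD1 x) //= big1 ?addr0 => [|y yx]; rewrite ffunE.
  by rewrite eqxx scale1r.
by rewrite (negbTE yx) scale0r.
Qed.

(** The coset of t_i B consists of the T_i x, whose letters at i - 1 and i agree, and
    the T_i x + e_i, whose letters at i - 1 and i differ, for x in the coset of B. *)
Lemma induce_f_elt (D i k : nat) (B : {fset intv}) : (1 <= i <= D.+2)%N ->
    B \in S_set D ->
  induce i (f_elt R (E_of D B) k) = f_elt R (E_of D.+2 (t_map i B)) k.
Proof.
move=> iD BS; have Br := S_range BS.
rewrite /f_elt linear_sum /=; under eq_bigr do rewrite induce_formal.
rewrite big_split /=.
rewrite [RHS](bigID (fun v : 'V_D.+2 => supp v i == supp v i.-1)) /=.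
have flat x : supp (x *m lift_mx D i) i = supp (x *m lift_mx D i) i.-1.
  rewrite !supp_lift /collapse ltnn eqxx iD /=; case: i {BS} iD => [//|[|j]] jD.
    by rewrite supp_0.
  by rewrite [(j.+2.-1 < j.+2)%N]ltnSn /=; have -> : (j < D.+2)%N by lia.
have bent x : supp (x *m lift_mx D i + e_vec D.+2 i) i !=
              supp (x *m lift_mx D i + e_vec D.+2 i) i.-1.
  rewrite !suppD !supp_e_vec flat eqxx iD (_ : i.-1 == i = false); last by lia.
  by rewrite andbF addbF addbT; case: (supp _ _).
have back v : v - v_vec (E_of D.+2 (t_map i B)) k \in E_of D.+2 (t_map i B) ->
    v = contract i v *m lift_mx D i \/ v = contract i v *m lift_mx D i + e_vec D.+2 i.
  move=> /coset_t_map [] // x _ vx; apply: contractK => //.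
  case: vx => ->; first exact: lift_flat.
  by rewrite !suppD (lift_flat _ iD) !supp_e_vec; congr addb; lia.
congr (_ + _).
  rewrite [RHS](reindex_onto (fun x => x *m lift_mx D i) (contract i)) /=.
    apply: eq_bigl => x; rewrite lift_mxK // eqxx flat eqxx !andbT.
    by rewrite v_vec_t_map // -mulmxBl mem_E_lift.
  move=> v /andP [/back [//|vE] /eqP vf].
  by have := bent (contract i v); rewrite -vE vf eqxx.
rewrite [RHS](reindex_onto (fun x => x *m lift_mx D i + e_vec D.+2 i) (contract i)) /=.
  apply: eq_bigl => x; rewrite lift_mxKe // eqxx bent !andbT.
  by rewrite v_vec_t_map // addrAC -mulmxBl mem_E_lift_e.
move=> v /andP [/back [vE|//]].
by have := flat (contract i v); rewrite -vE => ->; rewrite eqxx.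
Qed.

Lemma F_pairsP (D k : nat) (E : {vspace 'V_D}) :
  reflect (exists2 B, B \in S_set D & E = E_of D B /\ (k <= D %/ 2 - #|` B|)%N)
    ((E, k) \in F_pairs D).
Proof.
rewrite /F_pairs inE; apply: (iffP allpairsPdep).
  case=> E' [k' [+ + [-> ->]]]; rewrite mem_iota => /imfsetP [B BS ->] kI.
  by exists B => //; split=> //; rewrite -ltnS -(dim_E_of BS).
case=> B BS [-> kD]; exists (E_of D B), k; split=> //.
  by apply/imfsetP; exists B.
by rewrite mem_iota dim_E_of // add0n ltnS.
Qed.

Definition f_list (D k : nat) : seq (CV R D) :=
  [seq f_elt R p.1 p.2 | p <- enum_fset (F_pairs D) & p.2 == k].

Lemma mem_f_list (D k : nat) (B : {fset intv}) : B \in S_set D ->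
  (k <= D %/ 2 - #|` B|)%N -> f_elt R (E_of D B) k \in f_list D k.
Proof.
move=> BS kD; apply/mapP; exists (E_of D B, k) => //.
by rewrite mem_filter eqxx; apply/F_pairsP; exists B.
Qed.

Lemma induce_span (D i k : nat) (g : CV R D) : (1 <= i <= D.+2)%N ->
  g \in <<f_list D k>>%VS -> induce i g \in <<f_list D.+2 k>>%VS.
Proof.
move=> iD gW; have -> : induce i g = linfun (@induce D i) g by rewrite lfunE.
have: linfun (@induce D i) g \in (linfun (@induce D i) @: <<f_list D k>>)%VS.
  exact: memv_img.
rewrite limg_span; apply/subvP/span_subvP => _ /mapP [_ /mapP [[E k'] + ->] ->].
rewrite mem_filter => /andP [/eqP /= -> /F_pairsP [B BS [-> kD]]].
rewrite lfunE /= induce_f_elt //; apply/memv_span/mem_f_list; first exact: S_set_t.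
by rewrite card_t_map; lia.
Qed.

Lemma formal_w_vec (D k : nat) : formal R (w_vec D k) = f_elt R (E_of D fset0) k.
Proof.
apply/ffunP => y.
by rewrite f_eltE ffunE v_vec_fset0 /E_of span_nil memv0 subr_eq0.
Qed.

(** Membership in the span is transported along flips, from w_k to every vector of
    level k. *)
Lemma formal_span_flips (D : nat) : ~~ odd D ->
    (forall (v : 'V_D) i, (1 <= i <= D)%N -> supp v i.-1 = supp v i.+1 ->
       formal R v + formal R (v + e_vec D i) \in <<f_list D (u_tilde v)>>%VS) ->
  forall v : 'V_D, formal R v \in <<f_list D (u_tilde v)>>%VS.
Proof.
move=> Deven flips v; have := u_tilde_le v Deven; move uv : (u_tilde v) => k kD.
pose Q (x : 'V_D) := u_tilde x = k /\ formal R x \in <<f_list D k>>%VS.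
suff [] : Q v by [].
apply: (flip_connected (Q := Q) _ (v := w_vec D k)).
- move=> x i iD xi [xk xW]; split.
    by rewrite -xk; apply/u_tilde_eq/wall_sum_flip.
  by have := flips x i iD xi; rewrite xk rpredDl.
- by rewrite u_tilde_w_vec.
split; first exact: u_tilde_w_vec.
by rewrite formal_w_vec; apply/memv_span/mem_f_list; rewrite ?S_set0 // cardfs0; lia.
Qed.

(** For v flat at i, the contraction x of v has the same level, and [v] + [v + e_i] is
    induced from [x]. *)
Lemma formal_span (n : nat) (v : 'V_(n.*2)) :
  formal R v \in <<f_list n.*2 (u_tilde v)>>%VS.
Proof.
elim: n v => [|n IH]; apply: formal_span_flips; rewrite ?odd_double //.
  by move=> v i iD; lia.
move=> v i iD vi; set x := contract i v.
have ux : u_tilde v = u_tilde x.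
  apply: u_tilde_eq; case: (contractK iD vi) => ->; rewrite -/x.
    exact: wall_sum_lift.
  exact: wall_sum_t.
suff -> : formal R v + formal R (v + e_vec n.+1.*2 i) = induce i (formal R x).
  by rewrite ux; apply: induce_span.
have ee : e_vec n.*2.+2 i + e_vec n.*2.+2 i = 0.
  by apply: supp_inj => y; rewrite suppD addbb supp0.
rewrite induce_formal; case: (contractK iD vi) => vE; rewrite -/x in vE.
  by rewrite [in LHS]vE.
rewrite [in LHS]vE.
by rewrite -addrA ee addr0 addrC.
Qed.

Lemma f_elt_sub (D k : nat) (B : {fset intv}) : ~~ odd D -> B \in S_set D ->
  (k <= D %/ 2 - #|` B|)%N -> f_elt R (E_of D B) k \in CV_sub R D k.
Proof.
move=> Deven BS kD; rewrite /f_elt; apply: memv_suml => v vE.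
apply/memv_span/map_f; rewrite mem_filter mem_enum andbT.
by apply/eqP; apply: (coset_u_tilde Deven BS _ vE); lia.
Qed.

Lemma span_f_list (D k : nat) : ~~ odd D -> <<f_list D k>>%VS = CV_sub R D k.
Proof.
move=> Deven; apply/eqP; rewrite eqEsubv; apply/andP; split.
  apply/span_subvP => _ /mapP [[E k'] + ->]; rewrite mem_filter.
  by move=> /andP [/eqP /= -> /F_pairsP [B BS [-> kD]]]; apply: f_elt_sub.
apply/span_subvP => _ /mapP [v + ->]; rewrite mem_filter => /andP [/eqP <- _].
have Dn : D = (D./2).*2 by lia.
by move: v; rewrite Dn => v; apply: formal_span.
Qed.

Lemma dim_CV (D : nat) : \dim {: CV R D} = (2 ^ D)%N.
Proof.
rewrite dimvf -[dim _]/(#|{: 'V_D}| * 1)%N muln1 card_mx mul1n.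
by rewrite card_Fp.
Qed.

(** Every pair is represented by a normal form, since dim E_B = |B|. *)
Lemma size_F_pairs (D : nat) : ~~ odd D -> (size (enum_fset (F_pairs D)) <= 2 ^ D)%N.
Proof.
move=> Deven; have Dn : D = (D./2).*2 by lia.
rewrite [X in (2 ^ X)%N]Dn -pair_count_total.
set L := [seq (E_of D B, k) | B <- normal_forms D./2 0, k <- iota 0 (D./2 - #|` B|).+1].
have -> : pair_count D./2 0 = size L.
  rewrite size_allpairs_dep sumnE big_map; apply: eq_bigr => B _.
  by rewrite size_iota.
apply: uniq_leq_size; first exact: fset_uniq.
move=> [E k] /F_pairsP [B BS [-> kD]]; apply/allpairsPdep; exists B, k; split=> //.
  by apply: S_set_normal_forms; rewrite -Dn.
by rewrite mem_iota; lia.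
Qed.

(** The spans of the f^k_E contain all [v], and there are at most dim C[V_D] of these
    elements. *)
Lemma f_elts_full (D : nat) : ~~ odd D ->
  basis_of (fullv : {vspace CV R D})
    [seq f_elt R p.1 p.2 | p <- enum_fset (F_pairs D)].
Proof.
move=> Deven; rewrite basisEdim size_map dim_CV size_F_pairs // andbT.
apply/subvP => g _.
have -> : g = \sum_(v : 'V_D) (g v : R[i]%C) *: formal R v.
  apply/ffunP => y; rewrite sum_ffunE (bigD1 y) //= big1 ?addr0 => [|v vy].
    by rewrite !ffunE eqxx [RHS]mulr1.
  by rewrite !ffunE eq_sym (negbTE vy) [LHS]mulr0.
apply: memv_suml => v _; apply: memvZ.
have : formal R v \in <<f_list D (u_tilde v)>>%VS.
  rewrite span_f_list //; apply/memv_span/map_f.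
  by rewrite mem_filter eqxx mem_enum.
apply/subvP/sub_span => f /mapP [p + ->]; rewrite mem_filter => /andP [_ pF].
exact: map_f.
Qed.

End Spanning.

Theorem mainTheorem4 (R : realType) (D : nat) (D_even : ~~ odd D) :
  (forall k : nat,
     basis_of (CV_sub R D k)
       [seq f_elt R p.1 p.2 | p <- enum_fset (F_pairs D) & p.2 == k])
  /\
  basis_of (fullv : {vspace CV R D})
    [seq f_elt R p.1 p.2 | p <- enum_fset (F_pairs D)].
Proof.
have full := f_elts_full R D_even; split=> // k.
rewrite /basis_of -/(f_list R D k) span_f_list // eqxx /=.
have /permPl pm := perm_filterC (fun p => p.2 == k) (enum_fset (F_pairs D)).
have := basis_free full; rewrite -(perm_free (perm_map _ pm)) map_cat.
exact: catl_free.
Qed.
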